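(* Let $\nu$ be a smooth complex valued function on $S^3$ with $|\nu|<1$, let $S^3_0$ be the standard CR 3-sphere, and let $S^3_1$ be $S^3$ with the CR structure whose $(0,1)$ tangent space is spanned by $\overline W_1=\overline W_0-\nu W_0$. If $g_s:S^3_1\to S^3_0$ is a flow of contact transformations generated by a smooth vector field with contact Hamiltonian function $u$, then for small $s\in\mathbb R$ the Beltrami tensor $\mu_{g_s}$ satisfies $$|\mu_{g_s}|=|\nu|+\frac{1-|\nu|^2}{|\nu|}\,\mathrm{Im}\big(\overline\nu\,\overline W_0^2u\big)\,s+\mathcal O(s^2)\qquad\text{where }\nu\neq0,$$ and $$|\mu_{g_s}|=\big|\overline W_0^2u\big|\cdot|s|+\mathcal O(s^2)\qquad\text{where }\nu=0.$$
   Context: $S^3=\{(w_1,w_2)\in\mathbb C^2: |w_1|^2+|w_2|^2=1\}$ with contact form $\eta=-\mathrm{Im}(w_1d\overline w_1+w_2d\overline w_2)$ and contact bundle $HS^3=\ker\eta$. $W_0=\overline w_2\frac{\partial}{\partial w_1}-\overline w_1\frac{\partial}{\partial w_2}$ and $\overline W_0$ span the $(1,0)$ and $(0,1)$ tangent spaces of $S^3_0$ (the CR structure inherited from $\mathbb C^2$); $\psi=w_2dw_1-w_1dw_2$, so $\langle\psi,W_0\rangle=1$, $\langle\psi,\overline W_0\rangle=0$. $W_1=W_0-\overline\nu\,\overline W_0$ is the conjugate of $\overline W_1$. The contact Hamiltonian function of a vector field $V$ generating a smooth flow of contact transformations (diffeomorphisms preserving $HS^3$) is the smooth real function $u=\langle\eta,V\rangle$.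 The flow satisfies $g_0=\mathrm{id}$. Beltrami tensor: for a $C^1$ contact mapping $f:S^3_1\to S^3_0$ preserving the orientation of $HS^3$, its Beltrami tensor $\mu_f$ is the section of $T^{1,0}S^3_1\otimes\wedge^{0,1}S^3_1$ such that $f_*\big(\overline W_1-\mu_f(\overline W_1)\big)\in T^{0,1}S^3_0$. Explicitly $\mu_f=\frac{\langle f^*\psi,\overline W_1\rangle}{\langle f^*\psi,W_1\rangle}W_1\otimes\overline\psi_1$, where $\overline\psi_1$ is the $(0,1)$ form on $S^3_1$ with $\langle\overline\psi_1,\overline W_1\rangle=1$, and $|\mu_f|=\left|\frac{\langle f^*\psi,\overline W_1\rangle}{\langle f^*\psi,W_1\rangle}\right|$. The asymptotics are as $s\to0$ at points of $S^3$. *)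

(* Defs.v *)
From Stdlib Require Import Reals Lra.
From Coquelicot Require Import Coquelicot.

(** * The space C^2 *)

Definition C2 : Type := (C * C)%type.

Definition C2_NM : NormedModule R_AbsRing :=
  prod_NormedModule R_AbsRing C_R_NormedModule C_R_NormedModule.

Definition RC2_NM : NormedModule R_AbsRing :=
  prod_NormedModule R_AbsRing R_NormedModule C2_NM.

Definition add2 (X Y : C2) : C2 := ((fst X + fst Y)%C, (snd X + snd Y)%C).

Definition scal2 (a : C) (X : C2) : C2 := ((a * fst X)%C, (a * snd X)%C).

Definition normsq2 (p : C2) : R := (Cmod (fst p) ^ 2 + Cmod (snd p) ^ 2)%R.

Definition S3 (p : C2) : Prop := normsq2 p = 1%R.

(** * Smooth functions *)

(* [F] is of class C^n on [U] (meant for open [U]): all iterated directional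
   derivatives of order at most [n] exist and are continuous on [U]. *)
Fixpoint Ck {E : NormedModule R_AbsRing} (n : nat) (U : E -> Prop) (F : E -> R)
  : Prop :=
  (forall x : E, U x -> continuous F x) /\
  match n with
  | O => True
  | S m => forall v : E,
      (forall x : E, U x -> ex_derive (fun t : R => F (plus x (scal t v))) 0%R) /\
      Ck m U (fun x : E => Derive (fun t : R => F (plus x (scal t v))) 0%R)
  end.

(* Smoothness on a subset [A] of a normed space, as usual for submanifolds:
   locally the restriction of an ambient smooth function.
   The values of [f] outside [A] are irrelevant. *)
Definition smooth_on {E : NormedModule R_AbsRing} (A : E -> Prop) (f : E -> R)
  : Prop :=
  forall x : E, A x ->
  exists (U : E -> Prop) (F : E -> R),
    open U /\ U x /\ (forall n : nat, Ck n U F) /\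
    (forall y : E, A y -> U y -> F y = f y).

Definition smooth_onC {E : NormedModule R_AbsRing} (A : E -> Prop) (f : E -> C)
  : Prop :=
  smooth_on A (fun x => Re (f x)) /\ smooth_on A (fun x => Im (f x)).

Definition smooth_onC2 {E : NormedModule R_AbsRing} (A : E -> Prop)
  (f : E -> C2) : Prop :=
  smooth_onC A (fun x => fst (f x)) /\ smooth_onC A (fun x => snd (f x)).

(** * Tangent vectors and differentials on the sphere *)

(* A real tangent vector of C^2 at [p] is identified with [X : C2]; it is tangent
   to the sphere when the real inner product of [X] and [p] vanishes. *)
Definition tangent (p X : C2) : Prop :=
  Re (fst X * Cconj (fst p) + snd X * Cconj (snd p))%C = 0%R.

Definition retract (q : C2) : C2 := scal2 (RtoC (/ sqrt (normsq2 q))) q.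

(* Derivative of a function on the sphere at [p] along [X] tangent at [p], taken
   along the curve [t |-> (p + t X) / |p + t X|] of the sphere; only the values of
   [f] on the sphere matter. *)
Definition dS (f : C2 -> C) (p X : C2) : C :=
  (Derive (fun t : R => Re (f (retract (add2 p (scal2 (RtoC t) X))))) 0%R,
   Derive (fun t : R => Im (f (retract (add2 p (scal2 (RtoC t) X))))) 0%R).

Definition dS2 (f : C2 -> C2) (p X : C2) : C2 :=
  (dS (fun q => fst (f q)) p X, dS (fun q => snd (f q)) p X).

(** * Complexified tangent vectors *)

(* [(X, Y)] stands for [X + i Y] in the complexification of the real vector space
   C^2; its complex structure is unrelated to multiplication by i in C^2. *)
Definition CT : Type := (C2 * C2)%type.

Definition CTadd (Z Z' : CT) : CT :=
  (add2 (fst Z) (fst Z'), add2 (snd Z) (snd Z')).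

Definition CTscal (c : C) (Z : CT) : CT :=
  (add2 (scal2 (RtoC (Re c)) (fst Z)) (scal2 (RtoC (- Im c)) (snd Z)),
   add2 (scal2 (RtoC (Re c)) (snd Z)) (scal2 (RtoC (Im c)) (fst Z))).

Definition CTsub (Z Z' : CT) : CT := CTadd Z (CTscal (RtoC (-1)) Z').

Definition CTconj (Z : CT) : CT := (fst Z, scal2 (RtoC (-1)) (snd Z)).

(* d/dw = (d/dx - i d/dy) / 2 in each variable *)
Definition d_w1 : CT :=
  ((RtoC (/ 2), RtoC 0), ((- (RtoC (/ 2) * Ci))%C, RtoC 0)).
Definition d_w2 : CT :=
  ((RtoC 0, RtoC (/ 2)), (RtoC 0, (- (RtoC (/ 2) * Ci))%C)).

(* The derivative [Z f] for [Z] complex tangent to the sphere at [p]. *)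
Definition app (Z : CT) (f : C2 -> C) (p : C2) : C :=
  (dS f p (fst Z) + Ci * dS f p (snd Z))%C.

Definition push (f : C2 -> C2) (p : C2) (Z : CT) : CT :=
  (dS2 f p (fst Z), dS2 f p (snd Z)).

(* complex-linear extension of a (complex valued) covector *)
Definition pair_form (w : C2 -> C) (Z : CT) : C :=
  (w (fst Z) + Ci * w (snd Z))%C.

(** * The standard CR and contact structures *)

Definition W0 (p : C2) : CT :=
  CTsub (CTscal (Cconj (snd p)) d_w1) (CTscal (Cconj (fst p)) d_w2).

Definition W0bar (p : C2) : CT := CTconj (W0 p).

(* the (0,1) tangent space of the standard sphere *)
Definition T01 (p : C2) (Z : CT) : Prop :=
  exists c : C, Z = CTscal c (W0bar p).

(* psi = w2 dw1 - w1 dw2 *)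
Definition psi (p X : C2) : C := (snd p * fst X - fst p * snd X)%C.

(* eta = - Im (w1 d(conj w1) + w2 d(conj w2)) *)
Definition eta (p X : C2) : R :=
  (- Im (fst p * Cconj (fst X) + snd p * Cconj (snd X))%C)%R.

Definition HS3 (p X : C2) : Prop := tangent p X /\ eta p X = 0%R.

(* the function \overline W_0^2 u *)
Definition W0bar_sq (u : C2 -> R) (p : C2) : C :=
  app (W0bar p) (fun q => app (W0bar q) (fun r => RtoC (u r)) q) p.

(** * Contact flows *)

Definition diffeo_S3 (f : C2 -> C2) : Prop :=
  (forall p, S3 p -> S3 (f p)) /\
  @smooth_onC2 C2_NM S3 f /\
  exists h : C2 -> C2,
    (forall p, S3 p -> S3 (h p)) /\
    @smooth_onC2 C2_NM S3 h /\
    (forall p, S3 p -> h (f p) = p) /\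
    (forall p, S3 p -> f (h p) = p).

Definition contact_transformation (f : C2 -> C2) : Prop :=
  diffeo_S3 f /\
  forall p X : C2, S3 p -> HS3 p X -> HS3 (f p) (dS2 f p X).

Definition smooth_vector_field (V : C2 -> C2) : Prop :=
  @smooth_onC2 C2_NM S3 V /\ forall p, S3 p -> tangent p (V p).

(* [g] is a smooth flow of contact transformations of the sphere generated by
   the vector field [V]; it is defined for all times since the sphere is compact. *)
Definition contact_flow (V : C2 -> C2) (g : R -> C2 -> C2) : Prop :=
  (forall s : R, contact_transformation (g s)) /\
  @smooth_onC2 RC2_NM (fun sp => S3 (snd sp)) (fun sp => g (fst sp) (snd sp)) /\
  (forall p, S3 p -> g 0%R p = p) /\
  (forall (s : R) (p : C2), S3 p ->
     @is_derive R_AbsRing C2_NM (fun t : R => g t p) s (V (g s p))).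

Definition contact_hamiltonian (V : C2 -> C2) (p : C2) : R := eta p (V p).

(** * The deformed structure and the Beltrami tensor *)

Definition W1bar (nu : C2 -> C) (p : C2) : CT :=
  CTsub (W0bar p) (CTscal (nu p) (W0 p)).

Definition W1 (nu : C2 -> C) (p : C2) : CT := CTconj (W1bar nu p).

(* <f^* psi, Z> at p *)
Definition pull_psi (f : C2 -> C2) (p : C2) (Z : CT) : C :=
  pair_form (psi (f p)) (push f p Z).

(* mu_f is [beltrami_coef nu f] times W_1 (x) \overline psi_1, so that
   mu_f(\overline W_1) = [beltrami_coef nu f p] W_1 at [p]; lemma [beltrami_coefP]
   relates it to the condition f_*(\overline W_1 - mu_f(\overline W_1)) in T^{0,1}. *)
Definition beltrami_coef (nu : C2 -> C) (f : C2 -> C2) (p : C2) : C :=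
  (pull_psi f p (W1bar nu p) / pull_psi f p (W1 nu p))%C.

Definition beltrami_norm (nu : C2 -> C) (f : C2 -> C2) (p : C2) : R :=
  Cmod (beltrami_coef nu f p).

(* e(s) = O(s^2) as s -> 0 *)
Definition bigO_sq (e : R -> R) : Prop :=
  exists K : R, locally 0%R (fun s : R => (Rabs (e s) <= K * s ^ 2)%R).

(** * Consistency facts *)

Local Ltac C_destruct :=
  unfold S3, HS3, tangent, eta, psi, pair_form, Re, Im in *; simpl in *.

Lemma S3E (p : C2) : S3 p ->
  (fst (fst p) ^ 2 + snd (fst p) ^ 2 + fst (snd p) ^ 2 + snd (snd p) ^ 2 = 1)%R.
Proof.
unfold S3, normsq2, Cmod; intros H.
rewrite <- !Rsqr_pow2, !Rsqr_sqrt in H; rewrite ?Rsqr_pow2 in *; try lra;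
  apply Rplus_le_le_0_compat; apply pow2_ge_0.
Qed.

Lemma psi_W0 (p : C2) : S3 p -> pair_form (psi p) (W0 p) = RtoC 1.
Proof.
intros H; apply S3E in H; destruct p as [[a b] [c d]]; C_destruct.
apply injective_projections; simpl.
- transitivity (a ^ 2 + b ^ 2 + c ^ 2 + d ^ 2)%R; [field | exact H].
- field.
Qed.

Lemma psi_W0bar (p : C2) : pair_form (psi p) (W0bar p) = RtoC 0.
Proof.
destruct p as [[a b] [c d]]; C_destruct.
apply injective_projections; simpl; field.
Qed.

Lemma HS3_span (q X : C2) : S3 q -> HS3 q X ->
  X = (psi q X * Cconj (snd q), - (psi q X * Cconj (fst q)))%C.
Proof.
intros Hq HX; apply S3E in Hq.
destruct q as [[a b] [c d]]; destruct X as [[x y] [z t]].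
C_destruct; destruct HX as [H1 H2].
assert (Hq' : (a * a + b * b + c * c + d * d = 1)%R) by lra.
assert (H3 : (x * a + y * b + z * c + t * d = 0)%R) by lra.
assert (H4 : (y * a - x * b + t * c - z * d = 0)%R) by lra.
apply injective_projections; apply injective_projections; simpl.
- transitivity (x * (a * a + b * b + c * c + d * d) - a * (x * a + y * b + z * c + t * d)
    + b * (y * a - x * b + t * c - z * d))%R; [rewrite Hq', H3, H4|]; ring.
- transitivity (y * (a * a + b * b + c * c + d * d) - b * (x * a + y * b + z * c + t * d)
    - a * (y * a - x * b + t * c - z * d))%R; [rewrite Hq', H3, H4|]; ring.
- transitivity (z * (a * a + b * b + c * c + d * d) - c * (x * a + y * b + z * c + t * d)
    + d * (y * a - x * b + t * c - z * d))%R; [rewrite Hq', H3, H4|]; ring.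
- transitivity (t * (a * a + b * b + c * c + d * d) - d * (x * a + y * b + z * c + t * d)
    - c * (y * a - x * b + t * c - z * d))%R; [rewrite Hq', H3, H4|]; ring.
Qed.

Lemma T01_psi (q : C2) (Z : CT) :
  S3 q -> HS3 q (fst Z) -> HS3 q (snd Z) ->
  (T01 q Z <-> pair_form (psi q) Z = RtoC 0).
Proof.
intros Hq HX HY; split.
- intros [c ->]; transitivity (c * pair_form (psi q) (W0bar q))%C.
  + clear; destruct q as [[a b] [e d]], c as [x y]; C_destruct.
    apply injective_projections; simpl; field.
  + rewrite psi_W0bar; apply Cmult_0_r.
- intros H; exists (2 * Cconj (psi q (fst Z)))%C.
  apply HS3_span in HX; [|assumption]; apply HS3_span in HY; [|assumption].
  destruct Z as [X Y]; simpl in *; unfold pair_form in H; simpl in H.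
  assert (HY2 : psi q Y = (Ci * psi q X)%C).
  { transitivity ((- Ci) * (psi q X + Ci * psi q Y) + Ci * psi q X)%C.
    - destruct (psi q X), (psi q Y); C_destruct.
      apply injective_projections; simpl; ring.
    - rewrite H; ring. }
  rewrite HY2 in HY; rewrite HX at 1; rewrite HY.
  generalize (psi q X); intros [x y]; destruct q as [[a b] [c d]]; C_destruct.
  repeat (apply injective_projections; simpl); field.
Qed.

(* At a point where [f] preserves the contact bundle, has a linear differential and
   satisfies <f^* psi, W_1> <> 0, [beltrami_coef] is the only [m] for which
   f_*(\overline W_1 - m W_1) is a (0,1) vector of the standard sphere. *)
Lemma beltrami_coefP (nu : C2 -> C) (f : C2 -> C2) (p : C2) (m : C) :
  S3 p -> S3 (f p) ->
  (forall X, HS3 p X -> HS3 (f p) (dS2 f p X)) ->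
  (forall X Y, HS3 p X -> HS3 p Y ->
     dS2 f p (add2 X Y) = add2 (dS2 f p X) (dS2 f p Y)) ->
  (forall (a : R) X, HS3 p X ->
     dS2 f p (scal2 (RtoC a) X) = scal2 (RtoC a) (dS2 f p X)) ->
  pull_psi f p (W1 nu p) <> RtoC 0 ->
  (T01 (f p) (push f p (CTsub (W1bar nu p) (CTscal m (W1 nu p)))) <->
   m = beltrami_coef nu f p).
Proof.
unfold beltrami_coef; intros Hp Hfp HH Hadd Hscal Hd.
assert (Hlc : forall X Y, HS3 p X -> HS3 p Y -> HS3 p (add2 X Y)).
{ clear; destruct p as [[a b] [c d]]; intros [[x y] [z t]] [[x' y'] [z' t']].
  C_destruct; intros [? ?] [? ?]; split; lra. }
assert (Hls : forall a X, HS3 p X -> HS3 p (scal2 (RtoC a) X)).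
{ clear; intros l; destruct p as [[a b] [c d]]; intros [[x y] [z t]].
  C_destruct; intros [H1 H2].
  apply (Rmult_eq_compat_l l) in H1; apply (Rmult_eq_compat_l l) in H2.
  split; lra. }
assert (H0 : HS3 p (fst (W0 p)) /\ HS3 p (snd (W0 p))).
{ clear; destruct p as [[a b] [c d]]; C_destruct; repeat split; field. }
destruct H0 as [H0 H0'].
assert (B : HS3 p (fst (W1bar nu p)) /\ HS3 p (snd (W1bar nu p))).
{ unfold W1bar, W0bar, CTsub, CTadd, CTconj, CTscal; simpl.
  split; auto 10. }
destruct B as [B B'].
assert (A : HS3 p (fst (W1 nu p)) /\ HS3 p (snd (W1 nu p))).
{ unfold W1, CTconj; simpl; split; auto. }
destruct A as [A A'].
set (Z := W1 nu p) in *; set (Z' := W1bar nu p) in *.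
clearbody Z Z'.
rewrite T01_psi; [|assumption| |].
2,3: unfold push; simpl; apply HH; unfold CTsub, CTadd, CTscal; simpl; auto 10.
assert (E : pair_form (psi (f p)) (push f p (CTsub Z' (CTscal m Z))) =
  (pull_psi f p Z' - m * pull_psi f p Z)%C).
{ unfold pull_psi, push, CTsub, CTadd, CTscal, Re, Im; cbn [fst snd RtoC].
  revert Hadd Hscal A A' B B'.
  generalize (dS2 f p) (fst Z) (snd Z) (fst Z') (snd Z') (f p).
  intros L X Y X' Y' q Hadd Hscal A A' B B'.
  repeat first [rewrite Hadd by auto 8 | rewrite Hscal by auto 8].
  generalize (L X) (L Y) (L X') (L Y') q; clear.
  intros [[? ?] [? ?]] [[? ?] [? ?]] [[? ?] [? ?]] [[? ?] [? ?]] [[? ?] [? ?]].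
  destruct m; C_destruct; apply injective_projections; simpl; ring. }
rewrite E; split.
- intros H; apply (f_equal (fun z => (z + m * pull_psi f p Z)%C)) in H.
  ring_simplify in H; rewrite H; field; exact Hd.
- intros ->; field; exact Hd.
Qed.

(* Main.v *)
(* Write A(s), B(s) for the pairings of g_s^* psi with \overline W_0 and W_0, so that
   the Beltrami coefficient is (A - nu B) / (B - \overline nu A), with A(0) = 0 and
   B(0) = 1.  Differentiating eta (dg_s X) = 0 at s = 0 shows that
   psi(V) = i \overline W_0 u, hence A'(0) = i \overline W_0^2 u, while B'(0) cancels
   to first order:
     mu = - nu + i (1 - |nu|^2) (\overline W_0^2 u) s + O(s^2).
   The expansions of A and B need only the symmetry of mixed derivatives, because the
   curve [arc] defining derivatives on the sphere stays in the plane spanned by p and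
   X; everything reduces to calculus of functions of two real variables. *)

Require Import Defs.
From Stdlib Require Import Reals Lra.
From Coquelicot Require Import Coquelicot.
Open Scope R_scope.

(** * Directional derivatives *)

(** Three features of the definitions shape the argument. [Ck] grants only continuous directional
    derivatives, so neither linearity in the direction nor the chain rule comes for free; both are
    recovered on a two-parameter affine family, where one continuous partial derivative together
    with the other one yields differentiability. [smooth_on] grants only extensions near a point,
    and an extension of the flow has time derivative V on the sphere alone; this suffices because
    the curve used by [dS] never leaves the sphere. Finally the remainder must be O(s^2) rather than
    o(s), so expansions are carried by [jet1] instead of derivatives. The slope B'(0) cancels
    because A(0) = 0 and B(0) = 1: it enters the slope of the quotient as - nu B'(0) from the
    numerator and as + nu B'(0) from the denominator. The modulus is smooth away from 0 but not at
    0, hence the two cases and the |s| in the second. *)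

Definition dirD {E : NormedModule R_AbsRing} (F : E -> R) (v x : E) : R :=
  Derive (fun t : R => F (plus x (scal t v))) 0.

(** The directions may be dependent: [dirD_scal] uses X twice, and on the sphere the first direction
    is the base point itself, that is, the radial one. *)
Definition plane {E : NormedModule R_AbsRing} (z X Y : E) (x y : R) : E :=
  plus (plus z (scal x X)) (scal y Y).

Lemma plane_00 {E : NormedModule R_AbsRing} (z X Y : E) : plane z X Y 0 0 = z.
Proof.
unfold plane.
change (plus (plus z (scal zero X)) (scal zero Y) = z).
now rewrite !scal_zero_l, !plus_zero_r.
Qed.

Lemma plane_shift_l {E : NormedModule R_AbsRing} (z X Y : E) (x y t : R) :
  plus (plane z X Y x y) (scal t X) = plane z X Y (x + t) y.
Proof.
unfold plane; rewrite (scal_distr_r x t X : scal (x + t) X = _).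
rewrite <- !plus_assoc; do 2 f_equal; apply plus_comm.
Qed.

Lemma plane_shift_r {E : NormedModule R_AbsRing} (z X Y : E) (x y t : R) :
  plus (plane z X Y x y) (scal t Y) = plane z X Y x (y + t).
Proof.
unfold plane; rewrite (scal_distr_r y t Y : scal (y + t) Y = _).
now rewrite <- !plus_assoc.
Qed.

Lemma continuous_plane {E : NormedModule R_AbsRing} (z X Y : E) (u : R * R) :
  continuous (fun u : R * R => plane z X Y (fst u) (snd u)) u.
Proof.
unfold plane.
apply @continuous_plus; [apply @continuous_plus|].
- apply continuous_const.
- apply @continuous_scal; [apply continuous_fst|apply continuous_const].
- apply @continuous_scal; [apply continuous_snd|apply continuous_const].
Qed.

Lemma Ck_dirD {E : NormedModule R_AbsRing} (n : nat) (U : E -> Prop)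
  (F : E -> R) (v : E) :
  Ck (S n) U F -> Ck n U (dirD F v).
Proof. intros [_ H]; apply (H v). Qed.

Lemma Ck_continuous {E : NormedModule R_AbsRing} (n : nat) (U : E -> Prop)
  (F : E -> R) (x : E) :
  Ck n U F -> U x -> continuous F x.
Proof. destruct n; intros [H _] Ux; now apply H. Qed.

Lemma is_derive_dirD {E : NormedModule R_AbsRing} (n : nat) (U : E -> Prop)
  (F : E -> R) (x v : E) :
  Ck (S n) U F -> U x ->
  is_derive (fun t : R => F (plus x (scal t v))) 0 (dirD F v x).
Proof.
intros [_ H] Ux; apply Derive_correct; now apply (H v).
Qed.

Lemma is_derive_translate (f : R -> R) (x l : R) :
  is_derive (fun t => f (x + t)) 0 l -> is_derive f x l.
Proof.
intros H.
apply (is_derive_ext (fun y => f (x + (y - x)))).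
{ intros t; f_equal; ring. }
evar_last.
apply (is_derive_comp (fun t => f (x + t)) (fun y => y - x)).
- replace (x - x) with 0 by ring; exact H.
- auto_derive; [exact I|reflexivity].
- apply Rmult_1_l.
Qed.

Lemma is_derive_plane_l {E : NormedModule R_AbsRing} (n : nat) (U : E -> Prop)
  (F : E -> R) (z X Y : E)
  (x y : R) : Ck (S n) U F -> U (plane z X Y x y) ->
  is_derive (fun t : R => F (plane z X Y t y)) x (dirD F X (plane z X Y x y)).
Proof.
intros HF HU; apply is_derive_translate.
apply (is_derive_ext (fun t => F (plus (plane z X Y x y) (scal t X)))).
{ intros t; now rewrite plane_shift_l. }
eapply is_derive_dirD; eassumption.
Qed.

Lemma is_derive_plane_r {E : NormedModule R_AbsRing} (n : nat) (U : E -> Prop)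
  (F : E -> R) (z X Y : E)
  (x y : R) : Ck (S n) U F -> U (plane z X Y x y) ->
  is_derive (fun t : R => F (plane z X Y x t)) y (dirD F Y (plane z X Y x y)).
Proof.
intros HF HU; apply is_derive_translate.
apply (is_derive_ext (fun t => F (plus (plane z X Y x y) (scal t Y)))).
{ intros t; now rewrite plane_shift_r. }
eapply is_derive_dirD; eassumption.
Qed.

Lemma locally_plane {E : NormedModule R_AbsRing} (U : E -> Prop) (z X Y : E) :
  open U -> U z ->
  locally (0, 0) (fun u : R * R => U (plane z X Y (fst u) (snd u))).
Proof.
intros oU Uz.
apply (continuous_plane z X Y (0, 0) U); simpl.
apply oU; now rewrite plane_00.
Qed.

(** Total differentiability in two variables follows from one partial derivative existing nearby and
    continuous at the point, and the other existing at the point; the chain rule for differentials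
    then applies. *)
Lemma is_derive_plane_curve {E : NormedModule R_AbsRing} (n : nat)
  (U : E -> Prop) (F : E -> R) (z X Y : E)
  (a b : R -> R) (a' b' : R) : open U -> Ck (S n) U F -> U z ->
  a 0 = 0 -> b 0 = 0 -> is_derive a 0 a' -> is_derive b 0 b' ->
  is_derive (fun t : R => F (plane z X Y (a t) (b t))) 0
    (a' * dirD F X z + b' * dirD F Y z).
Proof.
intros oU HF Uz a0 b0 Ha Hb.
assert (D : differentiable_pt_lim (fun x y => F (plane z X Y x y)) 0 0
  (dirD F X z) (dirD F Y z)).
{ apply filterdiff_differentiable_pt_lim.
  eapply filterdiff_ext_lin.
  - apply (is_derive_filterdiff (fun x y => F (plane z X Y x y)) 0 0
      (fun x y => dirD F X (plane z X Y x y)) (dirD F Y z)).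
    + generalize (locally_plane U z X Y oU Uz); apply filter_imp; intros u Hu.
      eapply is_derive_plane_l; eassumption.
    + replace (dirD F Y z) with (dirD F Y (plane z X Y 0 0))
        by now rewrite plane_00.
      eapply is_derive_plane_r; [eassumption|now rewrite plane_00].
    + apply continuous_comp; [apply continuous_plane|]; simpl; rewrite plane_00.
      eapply Ck_continuous; [apply Ck_dirD; eassumption|exact Uz].
  - intros [x y]; simpl; now rewrite plane_00. }
apply is_derive_Reals in Ha; apply is_derive_Reals in Hb; apply is_derive_Reals.
rewrite (Rmult_comm a'), (Rmult_comm b').
apply (derivable_pt_lim_comp_2d (fun x y => F (plane z X Y x y)));
  [now rewrite a0, b0| |]; assumption.
Qed.

Lemma dirD_comm {E : NormedModule R_AbsRing} (U : E -> Prop) (F : E -> R)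
  (z X Y : E) :
  open U -> Ck 2 U F -> U z -> dirD (dirD F X) Y z = dirD (dirD F Y) X z.
Proof.
intros oU HF Uz.
set (f := fun x y => F (plane z X Y x y)).
assert (L := locally_plane U z X Y oU Uz).
(* [DX] and [DY] hold throughout this open set, so they can be differentiated once more at each of
   its points. *)
assert (oV : open (fun u : R * R => U (plane z X Y (fst u) (snd u)))).
{ apply open_comp; [|exact oU]; intros u _; apply continuous_plane. }
assert (DX : forall x y, U (plane z X Y x y) ->
  Derive (fun t => f t y) x = dirD F X (plane z X Y x y)).
{ intros x y H; apply is_derive_unique; eapply is_derive_plane_l; eassumption. }
assert (DY : forall x y, U (plane z X Y x y) ->
  Derive (fun t => f x t) y = dirD F Y (plane z X Y x y)).
{ intros x y H; apply is_derive_unique; eapply is_derive_plane_r; eassumption. }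
assert (DXY : forall x y, U (plane z X Y x y) ->
  is_derive (fun t => Derive (fun s => f s t) x) y
    (dirD (dirD F X) Y (plane z X Y x y))).
{ intros x y H.
  eapply is_derive_ext_loc;
    [|eapply is_derive_plane_r; [apply Ck_dirD; exact HF|exact H]].
  apply (locally_2d_1d_const_x (fun x t =>
    dirD F X (plane z X Y x t) = Derive (fun s => f s t) x)).
  apply locally_2d_locally; apply (filter_imp (fun u : R * R =>
    U (plane z X Y (fst u) (snd u)))); [|apply (oV (x, y)); exact H].
  intros u Hu; symmetry; now apply DX. }
assert (DYX : forall x y, U (plane z X Y x y) ->
  is_derive (fun t => Derive (fun s => f t s) y) x
    (dirD (dirD F Y) X (plane z X Y x y))).
{ intros x y H.
  eapply is_derive_ext_loc;
    [|eapply is_derive_plane_l; [apply Ck_dirD; exact HF|exact H]].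
  apply (locally_2d_1d_const_y (fun t y =>
    dirD F Y (plane z X Y t y) = Derive (fun s => f t s) y)).
  apply locally_2d_locally; apply (filter_imp (fun u : R * R =>
    U (plane z X Y (fst u) (snd u)))); [|apply (oV (x, y)); exact H].
  intros u Hu; symmetry; now apply DY. }
rewrite <- (plane_00 z X Y) in Uz |- *.
rewrite <- (is_derive_unique _ _ _ (DXY 0 0 Uz)).
rewrite <- (is_derive_unique _ _ _ (DYX 0 0 Uz)).
symmetry; apply Schwarz.
- apply locally_2d_locally; revert L; apply filter_imp; intros [x y] H.
  repeat split; simpl.
  + eexists; eapply is_derive_plane_l; eassumption.
  + eexists; eapply is_derive_plane_r; eassumption.
  + eexists; apply DYX; exact H.
  + eexists; apply DXY; exact H.
- apply continuity_2d_pt_filterlim.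
  apply (continuous_ext_loc
    (fun u : R * R => Derive (fun s => Derive (fun t => f s t) (snd u)) (fst u))
    (fun u : R * R => dirD (dirD F Y) X (plane z X Y (fst u) (snd u))) (0, 0)).
  + revert L; apply filter_imp; intros [x y] H; symmetry.
    now apply is_derive_unique, DYX.
  + apply continuous_comp; [apply continuous_plane|].
    apply (Ck_continuous 0 U); [|exact Uz]; now do 2 apply Ck_dirD.
- apply continuity_2d_pt_filterlim.
  apply (continuous_ext_loc
    (fun u : R * R => Derive (fun s => Derive (fun t => f t s) (fst u)) (snd u))
    (fun u : R * R => dirD (dirD F X) Y (plane z X Y (fst u) (snd u))) (0, 0)).
  + revert L; apply filter_imp; intros [x y] H; symmetry.
    now apply is_derive_unique, DXY.
  + apply continuous_comp; [apply continuous_plane|].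
    apply (Ck_continuous 0 U); [|exact Uz]; now do 2 apply Ck_dirD.
Qed.

(** * First-order expansions at 0 *)

(** Stronger than differentiability at 0 with value a and slope b, and stable under arithmetic with
    the quadratic remainder that the theorem asserts. *)
Definition jet1 (f : R -> R) (a b : R) : Prop :=
  bigO_sq (fun s => f s - (a + b * s)).

Lemma locally_Rabs_lt (x d : R) : 0 < d ->
  locally x (fun y : R => Rabs (y - x) < d).
Proof. intros Hd; exists (mkposreal d Hd); intros y Hy; exact Hy. Qed.

Lemma bigO_sq_nonneg (e : R -> R) : bigO_sq e ->
  exists K, 0 <= K /\ locally 0 (fun s => Rabs (e s) <= K * s ^ 2).
Proof.
intros [K H]; exists (Rabs K); split; [apply Rabs_pos|].
revert H; apply filter_imp; intros s Hs.
eapply Rle_trans; [exact Hs|].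
apply Rmult_le_compat_r; [apply pow2_ge_0|apply Rle_abs].
Qed.

Lemma bigO_sq_dominated (e e' : R -> R) :
  locally 0 (fun s => Rabs (e' s) <= Rabs (e s)) -> bigO_sq e -> bigO_sq e'.
Proof.
intros L [K H]; exists K; generalize (filter_and _ _ L H).
apply filter_imp; intros s [H1 H2]; lra.
Qed.

Lemma bigO_sq_plus (e e' : R -> R) :
  bigO_sq e -> bigO_sq e' -> bigO_sq (fun s => e s + e' s).
Proof.
intros [K H] [K' H']; exists (K + K'); generalize (filter_and _ _ H H').
apply filter_imp; intros s [H1 H2].
eapply Rle_trans; [apply Rabs_triang|]; lra.
Qed.

Lemma bigO_sq_mult_l (h e : R -> R) (C : R) :
  locally 0 (fun s => Rabs (h s) <= C) -> bigO_sq e ->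
  bigO_sq (fun s => h s * e s).
Proof.
intros L [K H]; exists (C * K); generalize (filter_and _ _ L H).
apply filter_imp; intros s [H1 H2].
rewrite Rabs_mult, Rmult_assoc.
apply Rmult_le_compat; (apply Rabs_pos || assumption).
Qed.

Lemma bigO_sq_ext (e e' : R -> R) :
  locally 0 (fun s => e s = e' s) -> bigO_sq e -> bigO_sq e'.
Proof.
intros L; apply bigO_sq_dominated; revert L.
apply filter_imp; intros s ->; lra.
Qed.

Lemma bigO_sq_pow2 : bigO_sq (fun s => s ^ 2).
Proof.
exists 1; apply filter_forall; intros s.
rewrite Rabs_pos_eq by apply pow2_ge_0; lra.
Qed.

Lemma jet1_ext (f g : R -> R) (a b : R) :
  locally 0 (fun s => f s = g s) -> jet1 f a b -> jet1 g a b.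
Proof.
intros L; apply bigO_sq_ext; revert L; apply filter_imp; now intros s ->.
Qed.

Lemma jet1_const (c : R) : jet1 (fun _ => c) c 0.
Proof.
exists 0; apply filter_forall; intros s.
replace (c - (c + 0 * s)) with 0 by ring; rewrite Rabs_R0; lra.
Qed.

Lemma jet1_plus (f g : R -> R) (a b c d : R) :
  jet1 f a b -> jet1 g c d -> jet1 (fun s => f s + g s) (a + c) (b + d).
Proof.
intros Hf Hg; generalize (bigO_sq_plus _ _ Hf Hg); apply bigO_sq_ext.
apply filter_forall; intros s; ring.
Qed.

Lemma jet1_bounded (f : R -> R) (a b : R) : jet1 f a b ->
  exists C, locally 0 (fun s => Rabs (f s) <= C).
Proof.
intros H; destruct (bigO_sq_nonneg _ H) as [K [HK L]].
exists (K + (Rabs a + Rabs b)).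
generalize (filter_and _ _ L (locally_Rabs_lt 0 1 Rlt_0_1)).
apply filter_imp; intros s [H1 H2]; rewrite Rminus_0_r in H2.
replace (f s) with ((f s - (a + b * s)) + (a + b * s)) by ring.
eapply Rle_trans; [apply Rabs_triang|].
apply Rplus_le_compat.
- eapply Rle_trans; [exact H1|]; rewrite <- (Rmult_1_r K) at 2.
  apply Rmult_le_compat_l; [exact HK|]; rewrite <- pow2_abs.
  generalize (Rabs_pos s); nra.
- eapply Rle_trans; [apply Rabs_triang|]; rewrite Rabs_mult.
  generalize (Rabs_pos b) (Rabs_pos s); nra.
Qed.

(** The remainder splits as f (g - c - d s) + (c + d s) (f - a - b s) + b d s^2, and the factors of
    the two remainders are bounded near 0. *)
Lemma jet1_mult (f g : R -> R) (a b c d : R) :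
  jet1 f a b -> jet1 g c d ->
  jet1 (fun s => f s * g s) (a * c) (a * d + b * c).
Proof.
intros Hf Hg; destruct (jet1_bounded _ _ _ Hf) as [C HC].
assert (H1 := bigO_sq_mult_l f _ C HC Hg).
assert (H2 : bigO_sq (fun s => (c + d * s) * (f s - (a + b * s)))).
{ apply (bigO_sq_mult_l _ _ (Rabs c + Rabs d)); [|exact Hf].
  generalize (locally_Rabs_lt 0 1 Rlt_0_1).
  apply filter_imp; intros s H2; rewrite Rminus_0_r in H2.
  eapply Rle_trans; [apply Rabs_triang|]; rewrite Rabs_mult.
  generalize (Rabs_pos d) (Rabs_pos s); nra. }
assert (H3 : bigO_sq (fun s => (b * d) * s ^ 2)).
{ apply (bigO_sq_mult_l _ _ (Rabs (b * d))); [|apply bigO_sq_pow2].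
  apply filter_forall; intros s; apply Rle_refl. }
generalize (bigO_sq_plus _ _ (bigO_sq_plus _ _ H1 H2) H3); apply bigO_sq_ext.
apply filter_forall; intros s; ring.
Qed.

Lemma jet1_scal (k : R) (f : R -> R) (a b : R) :
  jet1 f a b -> jet1 (fun s => k * f s) (k * a) (k * b).
Proof.
intros H; generalize (jet1_mult _ _ _ _ _ _ (jet1_const k) H).
now rewrite Rmult_0_l, Rplus_0_r.
Qed.

Lemma jet1_minus (f g : R -> R) (a b c d : R) :
  jet1 f a b -> jet1 g c d -> jet1 (fun s => f s - g s) (a - c) (b - d).
Proof.
intros Hf Hg; generalize (jet1_plus _ _ _ _ _ _ Hf (jet1_scal (-1) _ _ _ Hg)).
replace (a - c) with (a + -1 * c) by ring.
replace (b - d) with (b + -1 * d) by ring.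
apply jet1_ext, filter_forall; intros s; ring.
Qed.

(** * Taylor remainders, composition and uniqueness of expansions *)

Lemma second_order_remainder (f : R -> R) (x : R) :
  locally x (fun y => ex_derive f y) -> ex_derive (Derive f) x ->
  exists K, locally x (fun y =>
    Rabs (f y - (f x + Derive f x * (y - x))) <= K * (y - x) ^ 2).
Proof.
intros [d Hd] [l Hl].
apply is_derive_Reals in Hl.
(* Tolerance 1 in the derivative l of f' at x bounds the increment of f' by (|l| + 1) |c - x| near
   x; the mean value theorem then gives K = |l| + 1. *)
destruct (Hl 1 Rlt_0_1) as [d' Hd'].
exists (Rabs l + 1).
exists (mkposreal _ (Rmin_stable_in_posreal d d')); intros y Hy.
assert (Hy1 : Rabs (y - x) < d).
{ eapply Rlt_le_trans; [exact Hy|apply Rmin_l]. }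
assert (Hy2 : Rabs (y - x) < d').
{ eapply Rlt_le_trans; [exact Hy|apply Rmin_r]. }
destruct (MVT_cor4 f (Derive f) x (Rabs (y - x))) with (b := y)
  as [c [Hc1 Hc2]].
- intros c Hc; apply Derive_correct, Hd.
  apply (Rle_lt_trans _ (Rabs (y - x))); assumption.
- apply Rle_refl.
- replace (f y - (f x + Derive f x * (y - x)))
    with ((Derive f c - Derive f x) * (y - x)) by lra.
  assert (Hc3 : Rabs (Derive f c - Derive f x) <= (Rabs l + 1) * Rabs (c - x)).
  { destruct (Req_dec c x) as [->|Hcx].
    - rewrite !Rminus_diag, Rabs_R0; lra.
    - assert (Hcx' : c - x <> 0) by lra.
      specialize (Hd' (c - x) Hcx' (Rle_lt_trans _ _ _ Hc2 Hy2)).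
      replace (x + (c - x)) with c in Hd' by ring.
      replace (Derive f c - Derive f x)
        with ((Derive f c - Derive f x) / (c - x) * (c - x)) by now field.
      rewrite Rabs_mult; apply Rmult_le_compat_r; [apply Rabs_pos|].
      set (q := (Derive f c - Derive f x) / (c - x)) in *.
      replace q with (l + (q - l)) by ring.
      eapply Rle_trans; [apply Rabs_triang|]; lra. }
  rewrite Rabs_mult, <- (pow2_abs (y - x)).
  assert (0 <= Rabs l) by apply Rabs_pos.
  assert (0 <= Rabs (c - x)) by apply Rabs_pos.
  apply (Rle_trans _ ((Rabs l + 1) * Rabs (y - x) * Rabs (y - x))); [|lra].
  apply Rmult_le_compat_r; [apply Rabs_pos|].
  eapply Rle_trans; [exact Hc3|]; apply Rmult_le_compat_l; lra.
Qed.

Lemma jet1_smooth (f : R -> R) : locally 0 (fun y => ex_derive f y) ->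
  ex_derive (Derive f) 0 -> jet1 f (f 0) (Derive f 0).
Proof.
intros H1 H2; destruct (second_order_remainder f 0 H1 H2) as [K HK].
exists K; revert HK; apply filter_imp; intros s; now rewrite Rminus_0_r.
Qed.

(** Continuity at 0 lets a bound valid near a be pulled back along f, as composition requires. *)
Lemma jet1_filterlim (f : R -> R) (a b : R) : jet1 f a b ->
  filterlim f (locally 0) (locally a).
Proof.
intros [K HK].
apply (filterlim_ext (fun s => (a + b * s) + (f s - (a + b * s)))).
{ intros s; ring. }
assert (Hlin : filterlim (fun s : R => a + b * s) (locally 0) (locally a)).
{ assert (Hc : continuous (fun s : R => a + b * s) 0).
  { apply (ex_derive_continuous (fun s => a + b * s)); auto_derive; exact I. }
  unfold continuous in Hc; now rewrite Rmult_0_r, Rplus_0_r in Hc. }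
assert (Hsq : forall k, filterlim (fun s : R => k * s ^ 2) (locally 0) (locally 0)).
{ intros k; assert (Hc : continuous (fun s : R => k * s ^ 2) 0).
  { apply (ex_derive_continuous (fun s => k * s ^ 2)); auto_derive; exact I. }
  unfold continuous in Hc; now rewrite pow_i, Rmult_0_r in Hc by auto. }
assert (Hrem : filterlim (fun s => f s - (a + b * s)) (locally 0) (locally 0)).
{ apply (filterlim_le_le (fun s => (- K) * s ^ 2) _ (fun s => K * s ^ 2) (Finite 0));
    [|apply Hsq|apply Hsq].
  revert HK; apply filter_imp; intros s Hs.
  apply Rabs_le_between in Hs; lra. }
assert (Hsum : filterlim (fun s => plus (a + b * s) (f s - (a + b * s)))
  (locally 0) (locally (plus a 0))).
{ eapply filterlim_comp_2; [exact Hlin|exact Hrem|apply (filterlim_plus a 0)]. }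
change (plus a 0) with (a + 0) in Hsum; now rewrite Rplus_0_r in Hsum.
Qed.

Lemma jet1_comp (h f : R -> R) (a b : R) :
  locally a (fun y => ex_derive h y) -> ex_derive (Derive h) a ->
  jet1 f a b -> jet1 (fun s => h (f s)) (h a) (Derive h a * b).
Proof.
intros H1 H2 Hf; destruct (second_order_remainder h a H1 H2) as [K HK].
(* Both factors of the square have value a - a = 0, so their product has zero value and zero
   slope. *)
assert (Hsq : bigO_sq (fun s => K * (f s - a) ^ 2)).
{ assert (Hfa := jet1_minus _ _ _ _ _ _ Hf (jet1_const a)).
  generalize (jet1_scal K _ _ _ (jet1_mult _ _ _ _ _ _ Hfa Hfa)).
  apply bigO_sq_ext, filter_forall; intros s; ring. }
assert (Hrem : bigO_sq (fun s => h (f s) - (h a + Derive h a * (f s - a)))).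
{ revert Hsq; apply bigO_sq_dominated.
  assert (L : locally 0 (fun s =>
    Rabs (h (f s) - (h a + Derive h a * (f s - a))) <= K * (f s - a) ^ 2)).
  { exact (jet1_filterlim _ _ _ Hf _ HK). }
  revert L; apply filter_imp; intros s Hs.
  eapply Rle_trans; [exact Hs|apply Rle_abs]. }
generalize (bigO_sq_plus _ _ Hrem (bigO_sq_mult_l (fun _ => Derive h a) _ _
  (filter_forall _ (fun _ => Rle_refl _)) Hf)).
apply bigO_sq_ext, filter_forall; intros s; ring.
Qed.

Lemma jet1_is_derive (f : R -> R) (a b : R) :
  jet1 f a b -> f 0 = a /\ is_derive f 0 b.
Proof.
intros H; destruct (bigO_sq_nonneg _ H) as [K [HK L]].
assert (f0 : f 0 = a).
{ generalize (locally_singleton _ _ L); rewrite pow_i, !Rmult_0_r by auto.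
  intros H0; generalize (Rabs_pos (f 0 - (a + 0))); intros H1.
  assert (H2 : Rabs (f 0 - (a + 0)) = 0) by (apply Rle_antisym; assumption).
  apply Rabs_eq_0 in H2; lra. }
split; [exact f0|apply is_derive_Reals; intros eps Heps].
assert (Hd : 0 < eps / (K + 1)) by (apply Rdiv_lt_0_compat; lra).
destruct (filter_and _ _ L (locally_Rabs_lt 0 _ Hd)) as [d D].
exists d; intros h h0 Hh; rewrite Rplus_0_l.
destruct (D h) as [D1 D2].
{ change (Rabs (h - 0) < d); now rewrite Rminus_0_r. }
rewrite Rminus_0_r in D2.
replace ((f h - f 0) / h - b) with ((f h - (a + b * h)) / h)
  by (rewrite f0; now field).
assert (0 < Rabs h) by now apply Rabs_pos_lt.
unfold Rdiv; rewrite Rabs_mult, Rabs_inv.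
apply Rmult_lt_reg_r with (Rabs h); [assumption|].
rewrite Rmult_assoc, Rinv_l, Rmult_1_r by lra.
eapply Rle_lt_trans; [exact D1|]; rewrite <- pow2_abs.
apply Rlt_div_r in D2; [|lra].
simpl; nra.
Qed.

(** Turns an identity valid for all s into an equation between slopes, as needed for the contact
    condition. *)
Lemma jet1_unique (f : R -> R) (a b c d : R) :
  jet1 f a b -> jet1 f c d -> a = c /\ b = d.
Proof.
intros H1 H2; apply jet1_is_derive in H1, H2; destruct H1 as [<- H1], H2 as [<- H2].
split; [reflexivity|].
now rewrite <- (is_derive_unique _ _ _ H1), <- (is_derive_unique _ _ _ H2).
Qed.

(** * Expansion along a line and linearity of directional derivatives *)

Lemma jet1_plane_l {E : NormedModule R_AbsRing} (n : nat) (U : E -> Prop)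
  (F : E -> R) (z X Y : E) : open U -> Ck (S (S n)) U F -> U z ->
  jet1 (fun s => F (plane z X Y s 0)) (F z) (dirD F X z).
Proof.
intros oU HF Uz.
assert (L : locally 0 (fun s => U (plane z X Y s 0))).
{ apply (locally_2d_1d_const_y (fun x y => U (plane z X Y x y))).
  apply locally_2d_locally; now apply locally_plane. }
assert (D : forall s, U (plane z X Y s 0) ->
  is_derive (fun s => F (plane z X Y s 0)) s (dirD F X (plane z X Y s 0))).
{ intros s Hs; eapply is_derive_plane_l; eassumption. }
rewrite <- (plane_00 z X Y) in Uz.
replace (F z) with (F (plane z X Y 0 0)) by now rewrite plane_00.
assert (D0 : Derive (fun s => F (plane z X Y s 0)) 0
  = dirD F X (plane z X Y 0 0)) by now apply is_derive_unique, D.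
rewrite plane_00 in D0; rewrite <- D0.
apply (jet1_smooth (fun s => F (plane z X Y s 0))).
- revert L; apply filter_imp; intros s Hs; eexists; now apply D.
- apply (ex_derive_ext_loc (fun s => dirD F X (plane z X Y s 0)));
    [|eexists; eapply is_derive_plane_l; [apply Ck_dirD; exact HF|exact Uz]].
  revert L; apply filter_imp; intros s Hs; symmetry.
  now apply is_derive_unique, D.
Qed.

(** The diagonal curve (t, t) in the plane of X and Y has direction X + Y. *)
Lemma dirD_plus {E : NormedModule R_AbsRing} (n : nat) (U : E -> Prop)
  (F : E -> R) (z X Y : E) : open U -> Ck (S n) U F -> U z ->
  dirD F (plus X Y) z = dirD F X z + dirD F Y z.
Proof.
intros oU HF Uz; apply is_derive_unique.
apply (is_derive_ext (fun t => F (plane z X Y t t))).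
{ intros t; unfold plane.
  rewrite (scal_distr_l t X Y : @scal R_Ring E t (plus X Y) = _).
  now rewrite plus_assoc. }
replace (dirD F X z + dirD F Y z) with (1 * dirD F X z + 1 * dirD F Y z) by ring.
eapply (is_derive_plane_curve n U F z X Y (fun t => t) (fun t => t));
  try assumption; try reflexivity; apply (@is_derive_id R_AbsRing).
Qed.

Lemma dirD_scal {E : NormedModule R_AbsRing} (n : nat) (U : E -> Prop)
  (F : E -> R) (z X : E) (a : R) : open U -> Ck (S n) U F -> U z ->
  dirD F (scal a X) z = a * dirD F X z.
Proof.
intros oU HF Uz; apply is_derive_unique.
apply (is_derive_ext (fun t => F (plane z X X (a * t) 0))).
{ intros t; unfold plane; rewrite (scal_zero_l X : scal 0 X = zero).
  rewrite plus_zero_r, Rmult_comm.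
  now rewrite (scal_assoc t a X : @scal R_Ring E t (scal a X) = _). }
replace (a * dirD F X z) with (a * dirD F X z + 0 * dirD F X z) by ring.
eapply (is_derive_plane_curve n U F z X X (fun t => a * t) (fun t => 0));
  try assumption; try ring; auto_derive; try exact I; ring.
Qed.

(** * Curves on the sphere *)

Definition arc (p X : C2) (t : R) : C2 := retract (add2 p (scal2 (RtoC t) X)).

(** Reciprocal length of p + t X for p on the sphere and X tangent at p: the cross term 2 t <p, X>
    vanishes, so p does not appear. *)
Definition shrink (X : C2) (t : R) : R := / sqrt (1 + t ^ 2 * normsq2 X).

Lemma normsq2E (p : C2) : normsq2 p =
  fst (fst p) ^ 2 + snd (fst p) ^ 2 + fst (snd p) ^ 2 + snd (snd p) ^ 2.
Proof.
unfold normsq2, Cmod.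
rewrite !pow2_sqrt; [ring| |]; apply Rplus_le_le_0_compat; apply pow2_ge_0.
Qed.

Lemma normsq2_ge0 (p : C2) : 0 <= normsq2 p.
Proof. unfold normsq2; apply Rplus_le_le_0_compat; apply pow2_ge_0. Qed.

Lemma normsq2_line (p X : C2) (t : R) : S3 p -> tangent p X ->
  normsq2 (add2 p (scal2 (RtoC t) X)) = 1 + t ^ 2 * normsq2 X.
Proof.
unfold S3, tangent; rewrite !normsq2E.
destruct p as [[a b] [c d]], X as [[x y] [z w]]; cbn; intros Hp HX.
apply Rminus_diag_uniq.
match type of Hp with ?h = _ => match type of HX with ?h' = _ =>
  transitivity (h - 1 + 2 * t * h'); [ring|rewrite Hp, HX; ring]
end end.
Qed.

Lemma shrink_radicand_gt0 (X : C2) (t : R) : 0 < 1 + t ^ 2 * normsq2 X.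
Proof. generalize (normsq2_ge0 X) (pow2_ge_0 t); nra. Qed.

Lemma arc_S3 (p X : C2) (t : R) : S3 p -> tangent p X -> S3 (arc p X t).
Proof.
intros Hp HX; assert (H := normsq2_line p X t Hp HX).
assert (Hpos := shrink_radicand_gt0 X t); rewrite <- H in Hpos.
unfold arc, retract; generalize dependent (add2 p (scal2 (RtoC t) X)); clear.
intros q _ Hq; unfold S3.
assert (Hs : sqrt (normsq2 q) <> 0).
{ apply Rgt_not_eq, sqrt_lt_R0, Hq. }
transitivity ((/ sqrt (normsq2 q)) ^ 2 * normsq2 q).
- generalize (/ sqrt (normsq2 q)); intros l; rewrite !normsq2E.
  destruct q as [[a b] [c d]]; cbn; ring.
- rewrite <- (pow2_sqrt (normsq2 q)) at 2 by lra; now field.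
Qed.

(** Relative to the base point p, the coordinates along p and X vanish at t = 0 and have velocity
    (0, 1): normalization contributes nothing to first order. *)
Lemma arc_plane (p X : C2) (t : R) : S3 p -> tangent p X ->
  arc p X t = @plane C2_NM p p X (shrink X t - 1) (shrink X t * t).
Proof.
intros Hp HX; unfold arc, retract; rewrite normsq2_line by assumption.
fold (shrink X t); generalize (shrink X t); intros l.
destruct p as [[a b] [c d]], X as [[x y] [z w]].
repeat apply injective_projections; cbn; unfold mult; cbn; ring.
Qed.

Lemma time_arc_plane (s : R) (p X : C2) (t : R) : S3 p -> tangent p X ->
  (s, arc p X t) = @plane RC2_NM (s, p) (0, p) (0, X)
    (shrink X t - 1) (shrink X t * t).
Proof.
intros Hp HX; rewrite arc_plane by assumption.
apply injective_projections; [|reflexivity].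
cbn; unfold mult; cbn; ring.
Qed.

Lemma shrink_0 (X : C2) : shrink X 0 = 1.
Proof.
unfold shrink; replace (1 + 0 ^ 2 * normsq2 X) with 1 by ring.
now rewrite sqrt_1, Rinv_1.
Qed.

(** [shrink X] is even in t. *)
Lemma is_derive_shrink (X : C2) : is_derive (shrink X) 0 0.
Proof.
unfold shrink; auto_derive.
- generalize (shrink_radicand_gt0 X 0); intros H.
  repeat split; [replace (0 * (0 * 1)) with (0 ^ 2) by ring; exact H|].
  replace (0 * (0 * 1)) with (0 ^ 2) by ring.
  now apply Rgt_not_eq, sqrt_lt_R0.
- unfold Rdiv; ring.
Qed.

Lemma is_derive_shrink_minus1 (X : C2) :
  is_derive (fun t => shrink X t - 1) 0 0.
Proof.
evar_last;
  [apply @is_derive_minus; [apply is_derive_shrink|apply @is_derive_const]|].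
apply Rminus_diag.
Qed.

Lemma is_derive_shrink_mult (X : C2) :
  is_derive (fun t => shrink X t * t) 0 1.
Proof.
evar_last; [apply (is_derive_mult (shrink X) (fun t => t));
  [apply is_derive_shrink|apply @is_derive_id|intros; apply Rmult_comm]|].
cbn; rewrite shrink_0; unfold mult; cbn; ring.
Qed.

Lemma arc_0 (p X : C2) : S3 p -> tangent p X -> arc p X 0 = p.
Proof.
intros Hp HX; rewrite arc_plane by assumption; rewrite shrink_0.
replace (1 - 1) with 0 by ring; rewrite Rmult_0_r; apply (@plane_00 C2_NM).
Qed.

Lemma continuous_shrink_pair (X : C2) :
  filterlim (fun t => (shrink X t - 1, shrink X t * t)) (locally 0)
    (locally (0, 0)).
Proof.
assert (H : continuous (fun t => (shrink X t - 1, shrink X t * t)) 0).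
{ apply (continuous_comp_2 (fun t => shrink X t - 1) (fun t => shrink X t * t)
    (fun x y => (x, y))).
  - apply @ex_derive_continuous; eexists; apply is_derive_shrink_minus1.
  - apply @ex_derive_continuous; eexists; apply is_derive_shrink_mult.
  - apply (continuous_ext (fun u : R * R => u)); [now intros []|].
    apply continuous_id. }
unfold continuous in H; rewrite shrink_0 in H.
now replace (1 - 1) with 0 in H by ring; rewrite Rmult_0_r in H.
Qed.

(** [dS] is defined one curve at a time, so its linearity needs a proof. L is the directional
    derivative at p of one local extension, common to all tangent X, because the radial coordinate
    of the curve has velocity 0. *)
Lemma smooth_on_arc (f : C2 -> R) (p : C2) : @smooth_on C2_NM S3 f -> S3 p ->
  exists L : C2 -> R,
    (forall X Y, L (add2 X Y) = L X + L Y) /\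
    (forall a X, L (scal2 (RtoC a) X) = a * L X) /\
    (forall X, tangent p X -> is_derive (fun t => f (arc p X t)) 0 (L X)).
Proof.
intros Hf Hp; destruct (Hf p Hp) as [U [F [oU [Up [HF HFf]]]]].
exists (fun X => @dirD C2_NM F X p); split; [|split].
- intros X Y; apply (@dirD_plus C2_NM 0 U); auto.
- intros a X; replace (scal2 (RtoC a) X) with (@scal R_Ring C2_NM a X).
  { apply (@dirD_scal C2_NM 0 U); auto. }
  destruct X as [[x y] [z w]].
  repeat apply injective_projections; cbn; unfold mult; cbn; ring.
- intros X HX.
  apply (is_derive_ext_loc
    (fun t => F (@plane C2_NM p p X (shrink X t - 1) (shrink X t * t)))).
  + assert (L : locally 0 (fun t =>
      U (@plane C2_NM p p X (shrink X t - 1) (shrink X t * t)))).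
    { exact (continuous_shrink_pair X _ (@locally_plane C2_NM U p p X oU Up)). }
    revert L; apply filter_imp; intros t Ht.
    rewrite <- arc_plane in Ht |- * by assumption.
    apply HFf; [now apply arc_S3|exact Ht].
  + replace (@dirD C2_NM F X p)
      with (0 * @dirD C2_NM F p p + 1 * @dirD C2_NM F X p) by ring.
    apply (@is_derive_plane_curve C2_NM 0 U F p p X); auto.
    * rewrite shrink_0; ring.
    * ring.
    * apply is_derive_shrink_minus1.
    * apply is_derive_shrink_mult.
Qed.

(** Exchange of the time derivative with the derivative along the curve. For a local extension F
    near (0, p), the inner derivative is that of F in direction (0, X); its slope in time is a mixed
    second derivative, and by symmetry it is the derivative along the curve of the time derivative
    of F. *)
Lemma time_smooth_jets (phi : R * C2 -> R) (v : C2 -> R) (p X : C2) :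
  @smooth_on RC2_NM (fun sp => S3 (snd sp)) phi -> S3 p -> tangent p X ->
  (forall q, S3 q -> is_derive (fun s => phi (s, q)) 0 (v q)) ->
  jet1 (fun s => phi (s, p)) (phi (0, p)) (v p) /\
  jet1 (fun s => Derive (fun t => phi (s, arc p X t)) 0)
    (Derive (fun t => phi (0, arc p X t)) 0) (Derive (fun t => v (arc p X t)) 0).
Proof.
intros Hphi Hp HX Hv.
destruct (Hphi (0, p) Hp) as [U [F [oU [Up [HF HFphi]]]]].
set (T := (1, (RtoC 0, RtoC 0)) : RC2_NM).
set (Y := (0, X) : RC2_NM).
assert (line : forall s q Z, (s, q) = @plane RC2_NM (0, q) T Z s 0).
{ intros s [[a b] [c d]] [l [[x y] [z w]]].
  repeat apply injective_projections; cbn; unfold mult; cbn; ring. }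
assert (L : locally 0 (fun s => U (s, p))).
{ apply (filter_imp (fun s => U (@plane RC2_NM (0, p) T T s 0))).
  { intros s; now rewrite <- line. }
  apply (locally_2d_1d_const_y (fun x y => U (@plane RC2_NM (0, p) T T x y))).
  apply locally_2d_locally; now apply (@locally_plane RC2_NM). }
assert (LX : forall s, U (s, p) -> locally 0 (fun t => U (s, arc p X t))).
{ intros s Hs.
  assert (M : locally 0 (fun t => U (@plane RC2_NM (s, p) (0, p) Y
    (shrink X t - 1) (shrink X t * t)))).
  { exact (continuous_shrink_pair X _
      (@locally_plane RC2_NM U (s, p) (0, p) Y oU Hs)). }
  revert M; apply filter_imp; intros t Ht.
  now rewrite time_arc_plane by assumption. }
assert (DX : forall n G s, U (s, p) -> Ck (S n) U G ->
  is_derive (fun t => G (s, arc p X t)) 0 (dirD G Y (s, p))).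
{ intros n G s Hs HG.
  apply (is_derive_ext (fun t => G (@plane RC2_NM (s, p) (0, p) Y
    (shrink X t - 1) (shrink X t * t)))).
  { intros t; now rewrite time_arc_plane. }
  replace (dirD G Y (s, p)) with (0 * dirD G ((0, p) : RC2_NM) (s, p)
    + 1 * dirD G Y (s, p)) by ring.
  apply (@is_derive_plane_curve RC2_NM n U G (s, p) (0, p) Y); auto.
  - rewrite shrink_0; ring.
  - ring.
  - apply is_derive_shrink_minus1.
  - apply is_derive_shrink_mult. }
(* F agrees with phi only over the sphere, so its time derivative is identified with v only
   there. *)
assert (DT : forall q, S3 q -> U (0, q) -> dirD F T (0, q) = v q).
{ intros q Hq Uq; rewrite <- (is_derive_unique _ _ _ (Hv q Hq)).
  apply Derive_ext_loc.
  assert (M : locally 0 (fun t => U (@plane RC2_NM (0, q) T T t 0))).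
  { apply (locally_2d_1d_const_y (fun x y => U (@plane RC2_NM (0, q) T T x y))).
    apply locally_2d_locally; now apply (@locally_plane RC2_NM). }
  revert M; apply filter_imp; intros t; rewrite <- line; intros Ht.
  assert (Hplus : plus ((0, q) : RC2_NM) (scal t T) = (t, q)).
  { transitivity (@plane RC2_NM (0, q) T T t 0); [|symmetry; apply line].
    unfold plane; now rewrite (scal_zero_l T : scal 0 T = zero), plus_zero_r. }
  rewrite Hplus; now apply HFphi. }
split.
- apply (jet1_ext (fun s => F (@plane RC2_NM (0, p) T T s 0))).
  { revert L; apply filter_imp; intros s Hs; rewrite <- line; now apply HFphi. }
  rewrite <- (HFphi (0, p)), <- DT by assumption.
  now apply (@jet1_plane_l RC2_NM 0 U).
- apply (jet1_ext (fun s => dirD F Y (@plane RC2_NM (0, p) T T s 0))).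
  { revert L; apply filter_imp; intros s Hs; rewrite <- line.
    transitivity (Derive (fun t => F (s, arc p X t)) 0).
    { symmetry; apply is_derive_unique; eapply DX; [exact Hs|exact (HF 1%nat)]. }
    apply Derive_ext_loc; generalize (LX s Hs); apply filter_imp; intros t Ht.
    apply HFphi; [now apply arc_S3|exact Ht]. }
  replace (Derive (fun t => phi (0, arc p X t)) 0) with (dirD F Y (0, p)).
  2:{ transitivity (Derive (fun t => F (0, arc p X t)) 0).
    { symmetry; apply is_derive_unique; eapply DX; [exact Up|exact (HF 1%nat)]. }
    apply Derive_ext_loc; generalize (LX 0 Up); apply filter_imp; intros t Ht.
    apply HFphi; [now apply arc_S3|exact Ht]. }
  replace (Derive (fun t => v (arc p X t)) 0) with (dirD (dirD F Y) T (0, p)).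
  { apply (@jet1_plane_l RC2_NM 0 U); auto; apply Ck_dirD, HF. }
  (* After the swap the time derivative is innermost, where [DT] identifies it with v along the
     curve. *)
  rewrite (@dirD_comm RC2_NM U F (0, p) Y T) by auto.
  transitivity (Derive (fun t => dirD F T (0, arc p X t)) 0).
  { symmetry; apply is_derive_unique; eapply DX; [exact Up|].
    apply Ck_dirD; exact (HF 2%nat). }
  apply Derive_ext_loc; generalize (LX 0 Up); apply filter_imp; intros t Ht.
  apply DT; [now apply arc_S3|exact Ht].
Qed.

(** * Complex-valued expansions *)

Definition jetC (f : R -> C) (a b : C) : Prop :=
  jet1 (fun s => Re (f s)) (Re a) (Re b) /\
  jet1 (fun s => Im (f s)) (Im a) (Im b).

Lemma jetC_ext (f g : R -> C) (a b : C) :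
  locally 0 (fun s => f s = g s) -> jetC f a b -> jetC g a b.
Proof.
intros L [H1 H2]; split; (eapply jet1_ext; [|eassumption]);
  revert L; apply filter_imp; now intros s ->.
Qed.

Lemma jetC_const (c : C) : jetC (fun _ => c) c 0%C.
Proof. split; apply jet1_const. Qed.

Lemma jetC_plus (f g : R -> C) (a b c d : C) : jetC f a b -> jetC g c d ->
  jetC (fun s => f s + g s)%C (a + c)%C (b + d)%C.
Proof. intros [H1 H2] [H3 H4]; split; now apply jet1_plus. Qed.

Lemma jetC_minus (f g : R -> C) (a b c d : C) : jetC f a b -> jetC g c d ->
  jetC (fun s => f s - g s)%C (a - c)%C (b - d)%C.
Proof. intros [H1 H2] [H3 H4]; split; now apply jet1_minus. Qed.

Lemma jetC_conj (f : R -> C) (a b : C) : jetC f a b ->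
  jetC (fun s => Cconj (f s)) (Cconj a) (Cconj b).
Proof.
intros [H1 H2]; split; [exact H1|].
generalize (jet1_scal (-1) _ _ _ H2); unfold Im, Cconj; simpl.
replace (- snd a) with (-1 * snd a) by ring.
replace (- snd b) with (-1 * snd b) by ring.
apply jet1_ext, filter_forall; intros s; ring.
Qed.

Lemma jetC_mult (f g : R -> C) (a b c d : C) : jetC f a b -> jetC g c d ->
  jetC (fun s => f s * g s)%C (a * c)%C (a * d + b * c)%C.
Proof.
intros [H1 H2] [H3 H4]; split.
- replace (Re (a * d + b * c)) with
    ((Re a * Re d + Re b * Re c) - (Im a * Im d + Im b * Im c))
    by (unfold Re, Im; simpl; ring).
  apply (jet1_minus (fun s => Re (f s) * Re (g s)) (fun s => Im (f s) * Im (g s)));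
    now apply jet1_mult.
- replace (Im (a * d + b * c)) with
    ((Re a * Im d + Re b * Im c) + (Im a * Re d + Im b * Re c))
    by (unfold Re, Im; simpl; ring).
  apply (jet1_plus (fun s => Re (f s) * Im (g s)) (fun s => Im (f s) * Re (g s)));
    now apply jet1_mult.
Qed.

(** * Inverse, square root, quotient and modulus *)

Lemma jet1_inv_at_1 (f : R -> R) (b : R) : jet1 f 1 b -> jet1 (fun s => / f s) 1
  (- b).
Proof.
assert (L : locally 1 (fun y : R => y <> 0)).
{ generalize (locally_Rabs_lt 1 1 Rlt_0_1); apply filter_imp.
  intros y Hy ->; rewrite Rminus_0_l, Rabs_Ropp, Rabs_R1 in Hy; lra. }
assert (D : forall y : R, y <> 0 -> is_derive Rinv y (- / y ^ 2)).
{ intros y Hy; auto_derive; [exact Hy|field; exact Hy]. }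
intros Hf; assert (H : jet1 (fun s => / f s) (/ 1) (Derive Rinv 1 * b)).
2:{ rewrite (is_derive_unique _ _ _ (D 1 R1_neq_R0)), Rinv_1 in H.
  now replace (- b) with (- / 1 ^ 2 * b) by field. }
apply jet1_comp; [| |exact Hf].
- revert L; apply filter_imp; intros y Hy; eexists; now apply D.
- apply (ex_derive_ext_loc (fun y => - / y ^ 2)).
  + revert L; apply filter_imp; intros y Hy; symmetry.
    now apply is_derive_unique, D.
  + auto_derive; lra.
Qed.

Lemma jet1_sqrt (f : R -> R) (a b : R) : 0 < a -> jet1 f a b ->
  jet1 (fun s => sqrt (f s)) (sqrt a) (b / (2 * sqrt a)).
Proof.
intros Ha Hf.
assert (L : locally a (fun y : R => 0 < y)).
{ generalize (locally_Rabs_lt a a Ha); apply filter_imp.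
  intros y Hy; apply Rabs_lt_between in Hy; lra. }
assert (D : forall y : R, 0 < y -> is_derive sqrt y (/ (2 * sqrt y))).
{ intros y Hy; auto_derive; [exact Hy|apply Rmult_1_l]. }
replace (b / (2 * sqrt a)) with (Derive sqrt a * b).
2:{ rewrite (is_derive_unique _ _ _ (D a Ha)); apply Rmult_comm. }
apply jet1_comp; [| |exact Hf].
- revert L; apply filter_imp; intros y Hy; eexists; now apply D.
- apply (ex_derive_ext_loc (fun y => / (2 * sqrt y))).
  + revert L; apply filter_imp; intros y Hy; symmetry.
    now apply is_derive_unique, D.
  + auto_derive; repeat split; [exact Ha|].
    assert (0 < sqrt a) by now apply sqrt_lt_R0.
    lra.
Qed.

Lemma jetC_inv_at_1 (f : R -> C) (b : C) : jetC f 1%C b ->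
  jetC (fun s => / f s)%C 1%C (- b)%C.
Proof.
intros [H1 H2].
(* The inverse of f is its conjugate over |f|^2, and |f|^2 has value 1 and slope 2 Re b. *)
assert (HN := jet1_inv_at_1 (fun s => Re (f s) * Re (f s) + Im (f s) * Im (f s))
  (2 * Re b)).
assert (HQ := jet1_plus _ _ _ _ _ _
  (jet1_mult _ _ _ _ _ _ H1 H1) (jet1_mult _ _ _ _ _ _ H2 H2)).
simpl in HQ; rewrite !Rmult_0_l, Rmult_0_r, !Rplus_0_r, !Rmult_1_l, Rmult_1_r in HQ.
replace (Re b + Re b) with (2 * Re b) in HQ by ring; specialize (HN HQ).
split.
- generalize (jet1_mult _ _ _ _ _ _ H1 HN).
  unfold Re; simpl.
  replace (1 * - (2 * fst b) + fst b * 1) with (- fst b) by ring.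
  rewrite Rmult_1_l; apply jet1_ext, filter_forall; intros s.
  unfold Re, Im, Rdiv; simpl; now rewrite !Rmult_1_r.
- generalize (jet1_scal (-1) _ _ _ (jet1_mult _ _ _ _ _ _ H2 HN)).
  unfold Im, Re; simpl.
  replace (-1 * (0 * - (2 * fst b) + snd b * 1)) with (- snd b) by ring.
  replace (-1 * (0 * 1)) with 0 by ring.
  apply jet1_ext, filter_forall; intros s.
  unfold Re, Im, Rdiv; simpl; rewrite !Rmult_1_r; ring.
Qed.

Lemma jetC_div_at_1 (f g : R -> C) (a b d : C) : jetC f a b -> jetC g 1%C d ->
  jetC (fun s => f s / g s)%C a (b - a * d)%C.
Proof.
intros Hf Hg.
replace (b - a * d)%C with (a * - d + b * 1)%C by ring.
replace a with (a * 1)%C at 1 by ring.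
now apply jetC_mult; [|apply jetC_inv_at_1].
Qed.

Lemma jet1_Cmod (f : R -> C) (a b : C) : a <> 0%C -> jetC f a b ->
  jet1 (fun s => Cmod (f s)) (Cmod a) (Re (Cconj a * b)%C / Cmod a).
Proof.
intros Ha [H1 H2].
assert (Ha' : 0 < Re a * Re a + Im a * Im a).
{ replace (Re a * Re a + Im a * Im a) with (Cmod a ^ 2).
  - apply pow_lt; now apply Cmod_gt_0.
  - unfold Cmod, Re, Im; rewrite pow2_sqrt; [ring|].
    apply Rplus_le_le_0_compat; apply pow2_ge_0. }
generalize (jet1_sqrt _ _ _ Ha' (jet1_plus _ _ _ _ _ _
  (jet1_mult _ _ _ _ _ _ H1 H1) (jet1_mult _ _ _ _ _ _ H2 H2))).
replace (sqrt (Re a * Re a + Im a * Im a)) with (Cmod a)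
  by (unfold Cmod, Re, Im; f_equal; ring).
replace (Re (Cconj a * b)%C / Cmod a) with
  ((Re a * Re b + Re b * Re a + (Im a * Im b + Im b * Im a)) / (2 * Cmod a)).
- apply jet1_ext, filter_forall; intros s; unfold Cmod, Re, Im; f_equal; ring.
- unfold Re, Im; simpl; field; now apply Rgt_not_eq, Cmod_gt_0.
Qed.

Lemma Cmod_le_Rabs_plus (z : C) : Cmod z <= Rabs (Re z) + Rabs (Im z).
Proof.
apply Rsqr_incr_0_var; [|generalize (Rabs_pos (Re z)) (Rabs_pos (Im z)); lra].
unfold Cmod; rewrite Rsqr_sqrt.
- rewrite <- (pow2_abs (fst z)), <- (pow2_abs (snd z)); unfold Rsqr, Re, Im.
  generalize (Rabs_pos (fst z)) (Rabs_pos (snd z)); nra.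
- apply Rplus_le_le_0_compat; apply pow2_ge_0.
Qed.

(** The reverse triangle inequality bounds the difference of |f s| and |b s| by |f s - b s|; it
    replaces differentiation of the modulus, impossible at 0. *)
Lemma bigO_sq_Cmod_zero (f : R -> C) (b : C) : jetC f 0%C b ->
  bigO_sq (fun s => Cmod (f s) - Cmod b * Rabs s).
Proof.
intros [[K1 H1] [K2 H2]]; exists (K1 + K2).
generalize (filter_and _ _ H1 H2); apply filter_imp; intros s [L1 L2].
rewrite <- (Cmod_R s), <- Cmod_mult.
assert (T : Rabs (Cmod (f s) - Cmod (b * s)) <= Cmod (f s - b * s)).
{ apply Rabs_le; split.
  - assert (H := Cmod_triangle (f s) (- (f s - b * s))).
    replace (f s + - (f s - b * s))%C with (b * s)%C in H by ring.
    rewrite Cmod_opp in H; lra.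
  - assert (H := Cmod_triangle (b * s) (f s - b * s)).
    replace (b * s + (f s - b * s))%C with (f s) in H by ring; lra. }
eapply Rle_trans; [exact T|]; eapply Rle_trans; [apply Cmod_le_Rabs_plus|].
rewrite Rmult_plus_distr_r; apply Rplus_le_compat.
- eapply Rle_trans; [|exact L1]; right; f_equal.
  unfold Re, Im; simpl; ring.
- eapply Rle_trans; [|exact L2]; right; f_equal.
  unfold Re, Im; simpl; ring.
Qed.

(* [A] and [B] stand for the pairings of the pulled back [psi] with
   \overline W_0 and W_0. *)
Lemma beltrami_quotient_jet (A B : R -> C) (n c b : C) :
  jetC A 0%C (Ci * c)%C -> jetC B 1%C b ->
  jetC (fun s => (A s - n * B s) / (B s - Cconj n * A s))%C
    (- n)%C (Ci * c * (1 - n * Cconj n))%C.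
Proof.
intros HA HB.
assert (HN := jetC_minus _ _ _ _ _ _ HA (jetC_mult _ _ _ _ _ _ (jetC_const n) HB)).
assert (HM := jetC_minus _ _ _ _ _ _ HB
  (jetC_mult _ _ _ _ _ _ (jetC_const (Cconj n)) HA)).
replace (0 - n * 1)%C with (- n)%C in HN by ring.
replace (1 - Cconj n * 0)%C with (RtoC 1) in HM by ring.
generalize (jetC_div_at_1 _ _ _ _ _ HN HM).
(* The slope is i c - n b + n (b - conj n i c), in which the terms in b cancel. *)
now match goal with |- jetC _ _ ?x -> jetC _ _ ?y => replace x with y by ring end.
Qed.

(** * Differentials on the sphere *)

Lemma is_derive_fst {U W : NormedModule R_AbsRing} (f : R -> U * W) (x : R)
  (l : U * W) :
  @is_derive R_AbsRing (prod_NormedModule R_AbsRing U W) f x l ->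
  is_derive (fun t => fst (f t)) x (fst l).
Proof.
intros H.
apply (@filterdiff_comp' R_AbsRing (AbsRing_NormedModule R_AbsRing)
  (prod_NormedModule R_AbsRing U W) _ f fst x (fun y => scal y l) fst H).
apply filterdiff_linear, is_linear_fst.
Qed.

Lemma is_derive_snd {U W : NormedModule R_AbsRing} (f : R -> U * W) (x : R)
  (l : U * W) :
  @is_derive R_AbsRing (prod_NormedModule R_AbsRing U W) f x l ->
  is_derive (fun t => snd (f t)) x (snd l).
Proof.
intros H.
apply (@filterdiff_comp' R_AbsRing (AbsRing_NormedModule R_AbsRing)
  (prod_NormedModule R_AbsRing U W) _ f snd x (fun y => scal y l) snd H).
apply filterdiff_linear, is_linear_snd.
Qed.

Definition derC (f : R -> C) (l : C) : Prop :=
  is_derive (fun t => Re (f t)) 0 (Re l) /\ is_derive (fun t => Im (f t)) 0 (Im l).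

Lemma derC_mult (f g : R -> C) (a b : C) : derC f a -> derC g b ->
  derC (fun t => f t * g t)%C (a * g 0 + f 0 * b)%C.
Proof.
intros [F1 F2] [G1 G2]; unfold derC.
assert (M : forall u v (x y : R), is_derive u 0 x -> is_derive v 0 y ->
  is_derive (fun t => u t * v t) 0 (x * v 0 + u 0 * y)).
{ intros u v x y Hu Hv; apply (is_derive_mult u v 0); auto.
  intros; apply Rmult_comm. }
split.
- replace (Re (a * g 0 + f 0 * b)) with
    (minus (Re a * Re (g 0) + Re (f 0) * Re b) (Im a * Im (g 0) + Im (f 0) * Im b))
    by (unfold minus, plus, opp, Re, Im; simpl; ring).
  apply (is_derive_minus (fun t => Re (f t) * Re (g t)) (fun t => Im (f t) * Im (g t)));
    now apply M.
- replace (Im (a * g 0 + f 0 * b)) with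
    (plus (Re a * Im (g 0) + Re (f 0) * Im b) (Im a * Re (g 0) + Im (f 0) * Re b))
    by (unfold plus, Re, Im; simpl; ring).
  apply (is_derive_plus (fun t => Re (f t) * Im (g t)) (fun t => Im (f t) * Re (g t)));
    now apply M.
Qed.

Lemma derC_minus (f g : R -> C) (a b : C) : derC f a -> derC g b ->
  derC (fun t => f t - g t)%C (a - b)%C.
Proof.
intros [F1 F2] [G1 G2]; split.
- now apply (is_derive_minus (fun t => Re (f t)) (fun t => Re (g t))).
- now apply (is_derive_minus (fun t => Im (f t)) (fun t => Im (g t))).
Qed.

Lemma derC_plus (f g : R -> C) (a b : C) : derC f a -> derC g b ->
  derC (fun t => f t + g t)%C (a + b)%C.
Proof.
intros [F1 F2] [G1 G2]; split.
- now apply (is_derive_plus (fun t => Re (f t)) (fun t => Re (g t))).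
- now apply (is_derive_plus (fun t => Im (f t)) (fun t => Im (g t))).
Qed.

Lemma derC_conj (f : R -> C) (a : C) : derC f a ->
  derC (fun t => Cconj (f t)) (Cconj a).
Proof.
intros [F1 F2]; split; [exact F1|].
now apply (is_derive_opp (fun t => Im (f t))).
Qed.

Lemma derC_const (c : C) : derC (fun _ => c) 0%C.
Proof. split; apply @is_derive_const. Qed.

Lemma dS_derC (f : C2 -> C) (p X : C2) (l : C) :
  derC (fun t => f (arc p X t)) l -> dS f p X = l.
Proof.
intros [H1 H2]; unfold dS; apply injective_projections; simpl.
- exact (is_derive_unique _ _ _ H1).
- exact (is_derive_unique _ _ _ H2).
Qed.

Lemma dS_ext (f h : C2 -> C) (p X : C2) : S3 p -> tangent p X ->
  (forall q, S3 q -> f q = h q) -> dS f p X = dS h p X.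
Proof.
intros Hp HX H; unfold dS.
f_equal; apply Derive_ext; intros t;
  now rewrite (H (retract (add2 p (scal2 (RtoC t) X))) (arc_S3 p X t Hp HX)).
Qed.

Lemma derC_dS (f : C2 -> C) (p X : C2) : @smooth_onC C2_NM S3 f -> S3 p ->
  tangent p X -> derC (fun t => f (arc p X t)) (dS f p X).
Proof.
intros [H1 H2] Hp HX.
destruct (smooth_on_arc _ p H1 Hp) as [L1 [_ [_ D1]]].
destruct (smooth_on_arc _ p H2 Hp) as [L2 [_ [_ D2]]].
split; apply Derive_correct; eexists; [now apply D1|now apply D2].
Qed.

Lemma dS_add (f : C2 -> C) (p X Y : C2) : @smooth_onC C2_NM S3 f -> S3 p ->
  tangent p X -> tangent p Y -> tangent p (add2 X Y) ->
  dS f p (add2 X Y) = (dS f p X + dS f p Y)%C.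
Proof.
intros [H1 H2] Hp HX HY HXY.
destruct (smooth_on_arc _ p H1 Hp) as [L1 [A1 [_ D1]]].
destruct (smooth_on_arc _ p H2 Hp) as [L2 [A2 [_ D2]]].
assert (E : forall Z, tangent p Z -> dS f p Z = (L1 Z, L2 Z)).
{ intros Z HZ; apply dS_derC; split; [now apply D1|now apply D2]. }
now rewrite !E, A1, A2.
Qed.

Lemma dS_scal (f : C2 -> C) (p X : C2) (a : R) : @smooth_onC C2_NM S3 f ->
  S3 p -> tangent p X -> tangent p (scal2 (RtoC a) X) ->
  dS f p (scal2 (RtoC a) X) = (RtoC a * dS f p X)%C.
Proof.
intros [H1 H2] Hp HX HaX.
destruct (smooth_on_arc _ p H1 Hp) as [L1 [_ [A1 D1]]].
destruct (smooth_on_arc _ p H2 Hp) as [L2 [_ [A2 D2]]].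
assert (E : forall Z, tangent p Z -> dS f p Z = (L1 Z, L2 Z)).
{ intros Z HZ; apply dS_derC; split; [now apply D1|now apply D2]. }
rewrite !E, A1, A2 by assumption.
apply injective_projections; simpl; ring.
Qed.

Lemma derC_arc (p X : C2) : S3 p -> tangent p X ->
  derC (fun t => fst (arc p X t)) (fst X) /\ derC (fun t => snd (arc p X t)) (snd X).
Proof.
intros Hp HX.
assert (M : forall (u w : R -> R) (a b : R), is_derive u 0 0 -> is_derive w 0 1 ->
  is_derive (fun t => a + u t * a + w t * b) 0 b).
{ intros u w a b Hu Hw.
  auto_derive; [split; [exists 0; exact Hu|split; [exists 1; exact Hw|exact I]]|].
  replace (Derive (fun x => u x) 0) with 0
    by (symmetry; now apply is_derive_unique).
  replace (Derive (fun x => w x) 0) with 1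
    by (symmetry; now apply is_derive_unique).
  ring. }
assert (D1 := is_derive_shrink_minus1 X); assert (D2 := is_derive_shrink_mult X).
split; split; (eapply is_derive_ext; [|eapply M; [exact D1|exact D2]]); intros t;
  rewrite arc_plane by assumption; reflexivity.
Qed.

(** * Complex tangent vectors and complex linearity of the pulled back psi *)

Lemma tangent_add (p X Y : C2) : tangent p X -> tangent p Y -> tangent p
  (add2 X Y).
Proof.
destruct p as [[a b] [c d]], X as [[x y] [z t]], Y as [[x' y'] [z' t']].
unfold tangent; simpl; intros; lra.
Qed.

Lemma tangent_scal (p X : C2) (a : R) : tangent p X -> tangent p
  (scal2 (RtoC a) X).
Proof.
destruct p as [[b b'] [c d]], X as [[x y] [z t]].
unfold tangent; simpl; intros H; apply (Rmult_eq_compat_l a) in H; lra.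
Qed.

Definition tangentC (p : C2) (Z : CT) : Prop := tangent p (fst Z) /\ tangent p (snd Z).

Lemma HS3_W0 (p : C2) : HS3 p (fst (W0 p)) /\ HS3 p (snd (W0 p)).
Proof.
destruct p as [[a b] [c d]]; unfold HS3, tangent, eta; simpl.
repeat split; field.
Qed.

Lemma HS3_W0bar (p : C2) : HS3 p (fst (W0bar p)) /\ HS3 p (snd (W0bar p)).
Proof.
destruct p as [[a b] [c d]]; unfold HS3, tangent, eta; simpl.
repeat split; field.
Qed.

Lemma tangentC_W0 (p : C2) : tangentC p (W0 p).
Proof. now destruct (HS3_W0 p) as [[? _] [? _]]. Qed.

Lemma tangentC_W0bar (p : C2) : tangentC p (W0bar p).
Proof. now destruct (HS3_W0bar p) as [[? _] [? _]]. Qed.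

(** Real linearity of the differential on tangent vectors becomes complex linearity after
    complexification. This expands the pairings with the deformed frame in those with [W0] and
    [W0bar]. *)
Lemma pull_psi_comb (f : C2 -> C2) (p : C2) (m : C) (Z Z' : CT) :
  @smooth_onC2 C2_NM S3 f -> S3 p -> tangentC p Z -> tangentC p Z' ->
  pull_psi f p (CTsub Z' (CTscal m Z)) = (pull_psi f p Z' - m * pull_psi f p Z)%C.
Proof.
intros [F1 F2] Hp [HX HY] [HX' HY'].
assert (Hadd : forall X Y, tangent p X -> tangent p Y ->
  dS2 f p (add2 X Y) = add2 (dS2 f p X) (dS2 f p Y)).
{ intros X Y H H'; unfold dS2, add2 at 3; simpl.
  now rewrite !dS_add by (try apply tangent_add; assumption). }
assert (Hscal : forall (a : R) X, tangent p X ->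
  dS2 f p (scal2 (RtoC a) X) = scal2 (RtoC a) (dS2 f p X)).
{ intros a X H; unfold dS2, scal2 at 3; simpl.
  now rewrite !dS_scal by (try apply tangent_scal; assumption). }
assert (Ta := fun X Y => tangent_add p X Y).
assert (Ts := fun a X => tangent_scal p X a).
unfold pull_psi, push, CTsub, CTadd, CTscal, pair_form, Re, Im; cbn [fst snd RtoC].
repeat first [rewrite Hadd by auto 8 | rewrite Hscal by auto 8].
generalize (dS2 f p (fst Z)) (dS2 f p (snd Z)) (dS2 f p (fst Z')) (dS2 f p (snd Z'))
  (f p).
destruct m as [m1 m2].
intros [[? ?] [? ?]] [[? ?] [? ?]] [[? ?] [? ?]] [[? ?] [? ?]] [[? ?] [? ?]].
apply injective_projections; simpl; ring.
Qed.

(** * The contact flow *)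

Lemma contact_flow_smooth (V : C2 -> C2) (g : R -> C2 -> C2) (s : R) :
  contact_flow V g -> @smooth_onC2 C2_NM S3 (g s).
Proof. intros [H _]; now destruct (H s) as [[_ [H' _]] _]. Qed.

Lemma contact_flow_jets (V : C2 -> C2) (g : R -> C2 -> C2) (p X : C2) :
  contact_flow V g -> S3 p -> tangent p X ->
  (jetC (fun s => fst (g s p)) (fst p) (fst (V p)) /\
   jetC (fun s => snd (g s p)) (snd p) (snd (V p))) /\
  (jetC (fun s => fst (dS2 (g s) p X)) (fst X) (fst (dS2 V p X)) /\
   jetC (fun s => snd (dS2 (g s) p X)) (snd X) (snd (dS2 V p X))).
Proof.
intros [_ [[[S1 S2] [S3' S4]] [g0 Hg]]] Hp HX.
assert (D : forall q, S3 q ->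
  @is_derive R_AbsRing C2_NM (fun t => g t q) 0 (V q)).
{ intros q Hq; generalize (Hg 0 q Hq); now rewrite g0. }
assert (D1 : forall q, S3 q ->
  @is_derive R_AbsRing C_R_NormedModule (fun t => fst (g t q)) 0 (fst (V q))).
{ intros q Hq; exact (is_derive_fst (U := C_R_NormedModule)
    (W := C_R_NormedModule) _ _ _ (D q Hq)). }
assert (D2 : forall q, S3 q ->
  @is_derive R_AbsRing C_R_NormedModule (fun t => snd (g t q)) 0 (snd (V q))).
{ intros q Hq; exact (is_derive_snd (U := C_R_NormedModule)
    (W := C_R_NormedModule) _ _ _ (D q Hq)). }
(* One real coordinate [pr] at a time, each an instance of the exchange of derivatives. *)
assert (T : forall (pr : C2 -> R) (Y : R),
  @smooth_on RC2_NM (fun sp => S3 (snd sp)) (fun sp => pr (g (fst sp) (snd sp))) ->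
  (forall q, S3 q -> is_derive (fun s => pr (g s q)) 0 (pr (V q))) ->
  is_derive (fun t => pr (arc p X t)) 0 Y ->
  jet1 (fun s => pr (g s p)) (pr p) (pr (V p)) /\
  jet1 (fun s => Derive (fun t => pr (g s (arc p X t))) 0) Y
    (Derive (fun t => pr (V (arc p X t))) 0)).
{ intros pr Y Hs Hd HY.
  destruct (time_smooth_jets (fun sp => pr (g (fst sp) (snd sp)))
    (fun q => pr (V q)) p X Hs Hp HX Hd) as [J1 J2].
  simpl in J1, J2; rewrite g0 in J1 by assumption; split; [exact J1|].
  (* g_0 is the identity along the curve, so the initial value is the velocity of a coordinate of
     the curve itself. *)
  replace Y with (Derive (fun t => pr (g 0 (arc p X t))) 0); [exact J2|].
  rewrite <- (is_derive_unique _ _ _ HY); apply Derive_ext; intros t.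
  now rewrite g0 by now apply arc_S3. }
destruct (derC_arc p X Hp HX) as [[X1 X2] [X3 X4]].
assert (J1 := T (fun q => Re (fst q)) _ S1
  (fun q Hq => is_derive_fst _ _ _ (D1 q Hq)) X1).
assert (J2 := T (fun q => Im (fst q)) _ S2
  (fun q Hq => is_derive_snd _ _ _ (D1 q Hq)) X2).
assert (J3 := T (fun q => Re (snd q)) _ S3'
  (fun q Hq => is_derive_fst _ _ _ (D2 q Hq)) X3).
assert (J4 := T (fun q => Im (snd q)) _ S4
  (fun q Hq => is_derive_snd _ _ _ (D2 q Hq)) X4).
split; split; split; (apply J1 || apply J2 || apply J3 || apply J4).
Qed.

(** The slope is the pairing of Z with the Lie derivative of psi along V. The coefficients of psi
    are linear in the base point, so moving that point contributes psi with V p in place of p. *)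
Lemma pull_psi_flow_jet (V : C2 -> C2) (g : R -> C2 -> C2) (p : C2) (Z : CT) :
  contact_flow V g -> S3 p -> tangentC p Z ->
  jetC (fun s => pull_psi (g s) p Z) (pair_form (psi p) Z)
    (pair_form (psi (V p)) Z + pair_form (psi p) (push V p Z))%C.
Proof.
intros Hg Hp [HX HY].
destruct (contact_flow_jets V g p _ Hg Hp HX) as [[J1 J2] [K1 K2]].
destruct (contact_flow_jets V g p _ Hg Hp HY) as [_ [L1 L2]].
assert (JX := jetC_minus _ _ _ _ _ _ (jetC_mult _ _ _ _ _ _ J2 K1)
  (jetC_mult _ _ _ _ _ _ J1 K2)).
assert (JY := jetC_minus _ _ _ _ _ _ (jetC_mult _ _ _ _ _ _ J2 L1)
  (jetC_mult _ _ _ _ _ _ J1 L2)).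
generalize (jetC_plus _ _ _ _ _ _ JX
  (jetC_mult _ _ _ _ _ _ (jetC_const Ci) JY)).
match goal with |- jetC _ _ ?x -> jetC _ _ ?y =>
  replace x with y; [intros H; exact H|]
end.
unfold pair_form, psi, push; simpl fst; simpl snd; ring.
Qed.

(* d/ds at 0 of [eta (g_s p) (dg_s X) = 0] *)
Lemma contact_condition (V : C2 -> C2) (g : R -> C2 -> C2) (p X : C2) :
  contact_flow V g -> S3 p -> HS3 p X ->
  eta (V p) X + eta p (dS2 V p X) = 0.
Proof.
intros Hg Hp HX.
destruct (contact_flow_jets V g p X Hg Hp (proj1 HX)) as [[J1 J2] [K1 K2]].
destruct (jetC_plus _ _ _ _ _ _ (jetC_mult _ _ _ _ _ _ J1 (jetC_conj _ _ _ K1))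
  (jetC_mult _ _ _ _ _ _ J2 (jetC_conj _ _ _ K2))) as [_ I1].
(* [g s] preserves the contact bundle, so this imaginary part vanishes for every s; [I1] gives its
   slope by the Leibniz rule. *)
assert (I2 : jet1 (fun s => Im (fst (g s p) * Cconj (fst (dS2 (g s) p X)) +
  snd (g s p) * Cconj (snd (dS2 (g s) p X)))%C) 0 0).
{ apply (jet1_ext (fun _ => 0)); [|apply jet1_const].
  apply filter_forall; intros s; destruct Hg as [Hc _].
  destruct (proj2 (Hc s) p X Hp HX) as [_ He]; unfold eta in He; lra. }
destruct (jet1_unique _ _ _ _ _ I1 I2) as [_ He]; unfold eta.
rewrite <- Ropp_plus_distr, <- (Ropp_0), <- He; f_equal.
unfold Im; simpl; ring.
Qed.

(** * Derivatives of the contact Hamiltonian *)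

Lemma dS_hamiltonian (V : C2 -> C2) (g : R -> C2 -> C2) (p X : C2) :
  smooth_vector_field V -> contact_flow V g -> S3 p -> HS3 p X ->
  dS (fun q => RtoC (contact_hamiltonian V q)) p X = RtoC (2 * eta X (V p)).
Proof.
intros [[V1 V2] _] Hg Hp HX; assert (Ht := proj1 HX).
apply dS_derC.
destruct (derC_arc p X Hp Ht) as [X1 X2].
assert (D1 := derC_dS _ p X V1 Hp Ht); assert (D2 := derC_dS _ p X V2 Hp Ht).
destruct (derC_plus _ _ _ _ (derC_mult _ _ _ _ X1 (derC_conj _ _ D1))
  (derC_mult _ _ _ _ X2 (derC_conj _ _ D2))) as [_ D].
split; [|exact (@is_derive_const R_AbsRing R_NormedModule 0 0)].
apply (@is_derive_opp R_AbsRing R_NormedModule) in D; rewrite arc_0 in D by assumption.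
evar_last; [exact D|].
(* Leibniz gives eta X (V p) + eta p (dV X). The contact condition turns the second term into - eta
   (V p) X, which is again eta X (V p) by antisymmetry; hence the factor 2. *)
generalize (contact_condition V g p X Hg Hp HX).
unfold eta, dS2, opp, Im, Re; simpl; intros H; lra.
Qed.

(** With . summing over coordinates, 2 eta X V = i (X . conj V - conj X . V). A (0,1) vector kills
    the part complex linear in X, which leaves - i (w2 V1 - w1 V2) on [W0bar]. *)
Lemma app_W0bar_hamiltonian (V : C2 -> C2) (g : R -> C2 -> C2) (p : C2) :
  smooth_vector_field V -> contact_flow V g -> S3 p ->
  app (W0bar p) (fun q => RtoC (contact_hamiltonian V q)) p = (- Ci * psi p (V p))%C.
Proof.
intros HV Hg Hp; destruct (HS3_W0bar p) as [H1 H2]; unfold app.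
rewrite !(dS_hamiltonian V g) by assumption.
destruct p as [[a b] [c d]], (V _) as [[x y] [z t]]; unfold eta, psi.
apply injective_projections; simpl; field.
Qed.

(** Differentiating psi q (V q) along X also produces psi X (V p) = - psi (V p) X; this is complex
    linear in X, hence vanishes on [W0bar]. *)
Lemma W0bar_sq_hamiltonian (V : C2 -> C2) (g : R -> C2 -> C2) (p : C2) :
  smooth_vector_field V -> contact_flow V g -> S3 p ->
  W0bar_sq (contact_hamiltonian V) p =
  (- Ci * pair_form (psi p) (push V p (W0bar p)))%C.
Proof.
intros HV Hg Hp; destruct (HS3_W0bar p) as [[H1 _] [H2 _]].
assert (D : forall X, tangent p X ->
  dS (fun q => app (W0bar q) (fun r => RtoC (contact_hamiltonian V r)) q) p X =
  (- Ci * (psi X (V p) + psi p (dS2 V p X)))%C).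
{ intros X HX.
  (* The first derivative of the Hamiltonian is known on the sphere only, which is enough for
     [dS]. *)
  rewrite (dS_ext _ (fun q => - Ci * psi q (V q))%C p X Hp HX)
    by (intros q Hq; now apply (app_W0bar_hamiltonian V g)).
  destruct HV as [[V1 V2] _].
  destruct (derC_arc p X Hp HX) as [X1 X2].
  assert (D1 : derC (fun t => fst (V (arc p X t))) (fst (dS2 V p X)))
    by exact (derC_dS _ p X V1 Hp HX).
  assert (D2 : derC (fun t => snd (V (arc p X t))) (snd (dS2 V p X)))
    by exact (derC_dS _ p X V2 Hp HX).
  assert (D := derC_mult _ _ _ _ (derC_const (- Ci)%C)
    (derC_minus _ _ _ _ (derC_mult _ _ _ _ X2 D1) (derC_mult _ _ _ _ X1 D2))).
  cbv beta in D; rewrite arc_0 in D by assumption.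
  rewrite (dS_derC _ _ _ _ D); unfold psi; ring. }
unfold W0bar_sq, app at 1; rewrite !D by assumption.
unfold pair_form, push; simpl fst; simpl snd.
generalize (psi p (dS2 V p (fst (W0bar p)))) (psi p (dS2 V p (snd (W0bar p)))).
intros [k k'] [l l'].
destruct p as [[a b] [c d]], (V _) as [[x y] [z t]]; unfold psi.
apply injective_projections; simpl; field.
Qed.

(** The base points may differ because psi is complex linear in the vector at every q, while
    [W0bar p] is of type (0,1). The case q = p gives A(0) = 0, and q = V p removes the first term of
    A'(0). *)
Lemma pair_psi_W0bar (p q : C2) : pair_form (psi q) (W0bar p) = RtoC 0.
Proof.
destruct p as [[a b] [c d]], q as [[x y] [z t]]; unfold pair_form, psi.
apply injective_projections; simpl; field.
Qed.

(** * From the pairings with the standard frame to the Beltrami coefficient *)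

Lemma W1_comb (nu : C2 -> C) (p : C2) :
  W1 nu p = CTsub (W0 p) (CTscal (Cconj (nu p)) (W0bar p)).
Proof.
unfold W1, W1bar; destruct p as [[a b] [c d]], (nu _) as [x y].
repeat apply injective_projections; simpl; field.
Qed.

Theorem proposition5p1 (nu : C2 -> C) (V : C2 -> C2) (g : R -> C2 -> C2)
  (nu_smooth : @smooth_onC C2_NM S3 nu)
  (nu_lt1 : forall p : C2, S3 p -> (Cmod (nu p) < 1)%R)
  (V_smooth : smooth_vector_field V)
  (g_flow : contact_flow V g) :
  let u : C2 -> R := contact_hamiltonian V in
  forall p : C2, S3 p ->
  (nu p <> RtoC 0 ->
   bigO_sq (fun s : R =>
     beltrami_norm nu (g s) p -
     (Cmod (nu p) +
      (1 - Cmod (nu p) ^ 2) / Cmod (nu p) *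
      Im (Cconj (nu p) * W0bar_sq u p)%C * s))%R) /\
  (nu p = RtoC 0 ->
   bigO_sq (fun s : R =>
     beltrami_norm nu (g s) p - Cmod (W0bar_sq u p) * Rabs s)%R).
Proof.
intros u p Hp; set (n := nu p); set (c := W0bar_sq u p).
assert (HA := pull_psi_flow_jet V g p (W0bar p) g_flow Hp (tangentC_W0bar p)).
assert (HB := pull_psi_flow_jet V g p (W0 p) g_flow Hp (tangentC_W0 p)).
rewrite !pair_psi_W0bar in HA; rewrite (psi_W0 p Hp) in HB.
assert (Hc : (0 + pair_form (psi p) (push V p (W0bar p)) = Ci * c)%C).
{ unfold c, u; rewrite (W0bar_sq_hamiltonian V g) by assumption.
  generalize (pair_form (psi p) (push V p (W0bar p))); intros [x y].
  apply injective_projections; simpl; ring. }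
rewrite Hc in HA.
assert (HQ := beltrami_quotient_jet _ _ n _ _ HA HB).
assert (HQ' : jetC (fun s => beltrami_coef nu (g s) p) (- n)%C
  (Ci * c * (1 - n * Cconj n))%C).
{ revert HQ; apply jetC_ext, filter_forall; intros s.
  unfold beltrami_coef; rewrite W1_comb; unfold W1bar; fold n.
  assert (Hs := contact_flow_smooth V g s g_flow).
  assert (T := tangentC_W0 p); assert (T' := tangentC_W0bar p).
  now rewrite !pull_psi_comb by assumption. }
clear HQ; split; intros Hn.
- assert (Hn' : (- n)%C <> RtoC 0).
  { intros H; apply Hn; replace n with (- - n)%C by ring; rewrite H; ring. }
  generalize (jet1_Cmod _ _ _ Hn' HQ').
  assert (H0 : Cmod n <> 0) by now apply Rgt_not_eq, Cmod_gt_0.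
  assert (H1 : (n * Cconj n)%C = RtoC (Cmod n ^ 2)).
  { unfold Cmod; rewrite pow2_sqrt
      by (apply Rplus_le_le_0_compat; apply pow2_ge_0).
    apply injective_projections; simpl; ring. }
  rewrite Cmod_opp, H1.
  (* The factor 1 - |n|^2 is real, and Re (- conj n i c) = Im (conj n c). *)
  replace (Re (Cconj (- n) * (Ci * c * (1 - RtoC (Cmod n ^ 2)))) / Cmod n) with
    ((1 - Cmod n ^ 2) / Cmod n * Im (Cconj n * c)%C); [intros H; exact H|].
  generalize (Cmod n) H0; intros m Hm; unfold Re, Im; simpl; field; exact Hm.
- assert (HC : (- n = 0)%C) by (rewrite Hn; ring).
  rewrite HC in HQ'; generalize (bigO_sq_Cmod_zero _ _ HQ').
  (* For n = 0 the last factor is 1, and i has modulus 1. *)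
  replace (Cmod (Ci * c * (1 - n * Cconj n))) with (Cmod c); [intros H; exact H|].
  rewrite Hn.
  replace (Ci * c * (1 - 0 * Cconj 0))%C with (Ci * c)%C by ring.
  rewrite Cmod_mult, Cmod_Ci; ring.
Qed.
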